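(* Let $q(z)=\sum_{j=1}^N q_jz^j$ be a polynomial of degree $N\ge 1$ with all $q_j\ge0$ (so $0<q(1)<+\infty$ and $q(0)=0$). Let $b_1,\dots,b_N\in\mathbb{C}$ be all the zeros of the equation $q(z)=q(1)$, and suppose they are all distinct. Then the analytic solution $\Phi$ in the open unit disc of $$\int_{0}^{+\infty}\Phi\left(z\,e^{r(q(z)-q(1))}\right)dr=\frac{\Phi(z)}{q(1)}\quad(|z|<1),\qquad \Phi(0)=0,\qquad \Phi'(0)=1,$$ is $$\Phi(z)=z\prod_{j=1}^N\left(1-\frac{z}{b_j}\right)^{-1-\frac{q(1)}{q'(b_j)b_j}},\qquad |z|<1.$$
   Context: Complex powers are $w^{\beta}=\exp(\beta\operatorname{Log} w)$ with the principal branch of the logarithm. Under the hypotheses $|b_j|\ge 1$ for all $j$, so $\operatorname{Re}(1-z/b_j)>0$ for $|z|<1$. *)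

(* Defs.v *)
From Stdlib Require Import Reals.
From Coquelicot Require Export Coquelicot.

Open Scope C_scope.

Definition Cexp (z : C) : C :=
  (exp (Re z) * cos (Im z), exp (Re z) * sin (Im z))%R.

(* Principal argument, with values in (-PI, PI] for w <> 0. *)
Definition Carg (w : C) : R :=
  if Rle_dec 0 (Im w) then acos (Re w / Cmod w) else (- acos (Re w / Cmod w))%R.

Definition Clog (w : C) : C := (ln (Cmod w), Carg w).

(* Meaningful for w <> 0 only: Stdlib's ln is total, with ln 0 = 0. *)
Definition Cpower (w beta : C) : C := Cexp (beta * Clog w).

(* The polynomial has no constant term: the value q 0 is not used. *)
Definition qpoly (N : nat) (q : nat -> R) (z : C) : C :=
  sum_n_m (fun j => RtoC (q j) * z ^ j) 1 N.

(* Both bounds are included, as in sum_n_m. *)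
Definition Cprod_n_m (a : nat -> C) (m n : nat) : C :=
  Iter.iter_nat Cmult (RtoC 1) a m n.

Definition analytic_on_unit_disc (Phi : C -> C) : Prop :=
  forall z : C, (Cmod z < 1)%R -> ex_derive Phi z.

(* The improper integral is required to converge. Only the values of Phi on
   the open unit disc matter, since Re (q(z) - q(1)) < 0 there. *)
Definition is_solution (N : nat) (q : nat -> R) (Phi : C -> C) : Prop :=
  analytic_on_unit_disc Phi /\
  (forall z : C, (Cmod z < 1)%R ->
     is_RInt_gen (V := C_R_NormedModule)
       (fun r : R => Phi (z * Cexp (RtoC r * (qpoly N q z - qpoly N q 1))))
       (at_point 0%R) (Rbar_locally p_infty)
       (Phi z / qpoly N q 1)) /\
  Phi 0 = 0 /\
  is_derive Phi (RtoC 0) (RtoC 1).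

(* Main.v *)
Require Import Defs.
From Stdlib Require Import Reals Lra Lia Classical ClassicalEpsilon.
From Coquelicot Require Import Coquelicot.

(** Along [r -> z exp(r (q(z) - q(1)))] the integral of [Phi] telescopes: if [z F'(z) = Phi(z)] and
    [F(0) = 0], it equals [F(z) / (q(1) - q(z))], so the equation becomes
    [F'/F = q(1) / (z (q(1) - q(z)))], which partial fractions integrate to the product formula.

    Uniqueness needs no Cauchy theory. The difference [D] of two solutions satisfies [D(z) = o(z)]
    and the same integral equation, whose paths only visit points of smaller modulus and approach
    [0] at least as fast as [|z| exp(-r q(1) (1 - |z|))]. Hence [|D(z)|] can never catch up with a
    strict radial supersolution behaving like [|z|] at [0], however small its prefactor. *)

Open Scope C_scope.

(** * Complex exponential and logarithm *)

(** The exponents of [F] are the residues of [F'/F] at the roots, and those of [Phi] are lower by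
    one because the product of all [1 - z / b j] is [1 - q(z) / q(1)]. This factorisation and the
    partial fractions are polynomial identities of degree at most [N], checked at [0] and at the [N]
    distinct roots. The supersolution comes from running the telescoping backwards on radii. On a
    path of modulus [t exp(-k r)] a function [t I'(t)] integrates to [I(t) / k], and
    [k >= q(1) (1 - t)], so strictness amounts to [I(t) < (1 - t) t I'(t)]. For [I(t) = t exp(K t)]
    and [t > 0] this reads [(1 + K t) (1 - t) > 1], that is [K (1 - t) > 1]. Near the unit circle
    [K] has to blow up, so the comparison is made on discs of radius [rho0 < 1], with [K] fixed
    there before the prefactor tends to 0. At [t = 0] strictness is lost, and only [D(z) = o(z)] can
    start the comparison. *)

Lemma Cmod_le_Re_Im (z : C) : (Cmod z <= Rabs (Re z) + Rabs (Im z))%R.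
Proof.
  destruct z as [x y]. simpl.
  replace (x, y) with (RtoC x + Ci * RtoC y).
  - eapply Rle_trans. apply Cmod_triangle.
    rewrite Cmod_mult, Cmod_Ci, !Cmod_R. lra.
  - unfold Cplus, Cmult, Ci, RtoC; simpl. f_equal; ring.
Qed.

Lemma Rabs_Im_le_Cmod (z : C) : (Rabs (Im z) <= Cmod z)%R.
Proof.
  eapply Rle_trans; [apply Rmax_r | apply Rmax_Cmod].
Qed.

Lemma Cmod_triangle_minus (a b : C) : (Cmod a - Cmod b <= Cmod (a - b))%R.
Proof.
  assert (H := Cmod_triangle (a - b) b).
  replace (a - b + b) with a in H by ring. lra.
Qed.

Lemma Cexp_plus (a b : C) : Cexp (a + b) = Cexp a * Cexp b.
Proof.
  destruct a as [x y], b as [u v]. unfold Cexp, Cplus, Cmult; simpl.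
  rewrite exp_plus, cos_plus, sin_plus. f_equal; ring.
Qed.

Lemma Cexp_0 : Cexp 0 = 1.
Proof.
  unfold Cexp, RtoC; simpl. rewrite exp_0, cos_0, sin_0. f_equal; ring.
Qed.

Lemma Cmod_Cexp (z : C) : Cmod (Cexp z) = exp (Re z).
Proof.
  unfold Cmod, Cexp; simpl.
  replace (_ + _)%R with (exp (Re z) ^ 2 * ((sin (Im z))² + (cos (Im z))²))%R
    by (unfold Rsqr; ring).
  rewrite sin2_cos2, Rmult_1_r. apply sqrt_pow2, Rlt_le, exp_pos.
Qed.

Lemma Cexp_neq_0 (z : C) : Cexp z <> 0.
Proof.
  apply Cmod_gt_0. rewrite Cmod_Cexp. apply exp_pos.
Qed.

Lemma Cexp_opp (z : C) : Cexp (- z) = / Cexp z.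
Proof.
  assert (H : Cexp (- z) * Cexp z = 1).
  { rewrite <- Cexp_plus, <- Cexp_0. f_equal. ring. }
  assert (H0 := Cexp_neq_0 z).
  replace (Cexp (- z)) with (Cexp (- z) * Cexp z / Cexp z) by (field; auto).
  rewrite H. field; auto.
Qed.

(** The filter definition quantifies over all limit points of [locally z], and [z] is the only one.
    The epsilon-delta form lets later estimates be made with [Cmod] alone. *)
Lemma is_derive_C_iff (f : C -> C) (z l : C) :
  is_derive f z l <->
  forall eps : R, (0 < eps)%R -> exists d : R, (0 < d)%R /\
    forall w : C, (Cmod (w - z) < d)%R ->
      (Cmod (f w - f z - (w - z) * l) <= eps * Cmod (w - z))%R.
Proof.
  split.
  - intros [_ H] eps Heps.
    destruct (H z (fun P HP => HP) (mkposreal eps Heps)) as [d Hd].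
    exists d. split. apply cond_pos. intros w Hw. exact (Hd w Hw).
  - intros H. split. apply is_linear_scal_l.
    intros x Hx eps.
    apply (is_filter_lim_locally_unique (V := AbsRing_NormedModule C_AbsRing) z x) in Hx. subst x.
    destruct (H eps (cond_pos eps)) as [d [Hd Hw]].
    exists (mkposreal d Hd). intros w Hwd. exact (Hw w Hwd).
Qed.

Lemma is_derive_R_bound (f : R -> R) (x l : R) :
  is_derive f x l ->
  forall eps : R, (0 < eps)%R -> exists d : R, (0 < d)%R /\
    forall h : R, (Rabs h < d)%R ->
      (Rabs (f (x + h) - f x - h * l) <= eps * Rabs h)%R.
Proof.
  intros [_ H] eps Heps.
  destruct (H x (fun P HP => HP) (mkposreal eps Heps)) as [d Hd].
  exists d. split. apply cond_pos. intros h Hh.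
  assert (E : ball x d (x + h)%R).
  { unfold ball; simpl. unfold AbsRing_ball, abs, minus, plus, opp; simpl.
    replace (x + h + - x)%R with h by ring. exact Hh. }
  specialize (Hd _ E).
  unfold norm, minus, plus, opp, scal in Hd; simpl in Hd.
  unfold abs, mult in Hd; simpl in Hd.
  replace (x + h + - x)%R with h in Hd by ring. exact Hd.
Qed.

(** [Cexp] is given by real and imaginary parts, so its expansion at 0 is assembled from the real
    first-order expansions of [exp], [cos] and [sin]. *)
Lemma Cexp_minus_1_bound (eps : R) :
  (0 < eps)%R -> exists d : R, (0 < d)%R /\
    forall h : C, (Cmod h < d)%R -> (Cmod (Cexp h - 1 - h) <= eps * Cmod h)%R.
Proof.
  intros Heps.
  (* The errors [T1] to [T5] amount to 1 + 2 + 3 + 1 + 1 = 8 multiples of [e * m]. The cap at 1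
     gives [|1 + x| <= 2] and [exp x <= 3]. *)
  set (e := Rmin (eps / 8) 1).
  assert (He : (0 < e)%R) by (apply Rmin_glb_lt; lra).
  assert (He1 : (e <= 1)%R) by apply Rmin_r.
  assert (He8 : (8 * e <= eps)%R) by (assert (e <= eps / 8)%R by apply Rmin_l; lra).
  clearbody e.
  destruct (is_derive_R_bound exp 0 1 ltac:(auto_derive; [auto | rewrite exp_0; ring]) e He)
    as [d1 [Hd1 B1]].
  destruct (is_derive_R_bound cos 0 0 ltac:(auto_derive; [auto | rewrite sin_0; ring]) e He)
    as [d2 [Hd2 B2]].
  destruct (is_derive_R_bound sin 0 1 ltac:(auto_derive; [auto | rewrite cos_0; ring]) e He)
    as [d3 [Hd3 B3]].
  exists (Rmin (Rmin d1 d2) (Rmin d3 e)). split.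
  { repeat apply Rmin_glb_lt; assumption. }
  intros h Hh.
  assert (Hx := re_le_Cmod h). assert (Hy := Rabs_Im_le_Cmod h).
  assert (M1 := Rmin_l (Rmin d1 d2) (Rmin d3 e)).
  assert (M2 := Rmin_r (Rmin d1 d2) (Rmin d3 e)).
  assert (M3 := Rmin_l d1 d2). assert (M4 := Rmin_r d1 d2).
  assert (M5 := Rmin_l d3 e). assert (M6 := Rmin_r d3 e).
  specialize (B1 (Re h) ltac:(lra)). specialize (B2 (Im h) ltac:(lra)).
  specialize (B3 (Im h) ltac:(lra)).
  rewrite Rplus_0_l, exp_0 in B1. rewrite Rplus_0_l, cos_0 in B2.
  rewrite Rplus_0_l, sin_0 in B3.
  eapply Rle_trans. apply Cmod_le_Re_Im.
  revert Hx Hy B1 B2 B3.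
  set (m := Cmod h) in *. clearbody m.
  destruct h as [x y]; unfold Cexp, RtoC, Cminus, Cplus, Copp; simpl. intros.
  replace (exp x * cos y + - (1) + - x)%R
    with ((exp x - 1 - x * 1) * cos y + (1 + x) * (cos y - 1 - y * 0))%R by ring.
  replace (exp x * sin y + - 0 + - y)%R
    with (exp x * (sin y - 0 - y * 1) + (exp x - 1 - x * 1) * y + x * y)%R by ring.
  assert (Hc : (Rabs (cos y) <= 1)%R) by (apply Rabs_le; apply COS_bound).
  assert (Hex : (exp x <= 3)%R).
  { assert (E := Rabs_def2 (exp x - 1 - x * 1) (2 * Rabs x + e)). 
    assert (P := Rabs_pos x).
    assert (Q := Rle_abs (exp x - 1 - x * 1)). assert (Q' := Rle_abs x).
    assert (e * Rabs x <= 1 * Rabs x)%R by (apply Rmult_le_compat_r; lra). lra. }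
  assert (Px := Rabs_pos x). assert (Py := Rabs_pos y).
  assert (T1 : (Rabs ((exp x - 1 - x * 1) * cos y) <= e * Rabs x)%R).
  { rewrite Rabs_mult. rewrite <- (Rmult_1_r (e * Rabs x)).
    apply Rmult_le_compat; auto using Rabs_pos. }
  assert (T2 : (Rabs ((1 + x) * (cos y - 1 - y * 0)) <= 2 * (e * Rabs y))%R).
  { rewrite Rabs_mult. apply Rmult_le_compat; auto using Rabs_pos.
    eapply Rle_trans. apply Rabs_triang. rewrite Rabs_R1. lra. }
  assert (T3 : (Rabs (exp x * (sin y - 0 - y * 1)) <= 3 * (e * Rabs y))%R).
  { rewrite Rabs_mult. apply Rmult_le_compat; auto using Rabs_pos.
    rewrite Rabs_pos_eq; auto. apply Rlt_le, exp_pos. }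
  assert (T4 : (Rabs ((exp x - 1 - x * 1) * y) <= e * Rabs y)%R).
  { rewrite Rabs_mult. apply Rmult_le_compat_r; auto.
    eapply Rle_trans; [exact B1|]. rewrite <- (Rmult_1_r e) at 2.
    apply Rmult_le_compat_l; lra. }
  assert (T5 : (Rabs (x * y) <= e * Rabs y)%R).
  { rewrite Rabs_mult. apply Rmult_le_compat_r; auto. lra. }
  assert (U1 := Rabs_triang ((exp x - 1 - x * 1) * cos y) ((1 + x) * (cos y - 1 - y * 0))).
  assert (U2 := Rabs_triang (exp x * (sin y - 0 - y * 1) + (exp x - 1 - x * 1) * y) (x * y)).
  assert (U3 := Rabs_triang (exp x * (sin y - 0 - y * 1)) ((exp x - 1 - x * 1) * y)).
  assert (V1 : (e * Rabs x <= e * m)%R) by (apply Rmult_le_compat_l; lra).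
  assert (V2 : (e * Rabs y <= e * m)%R) by (apply Rmult_le_compat_l; lra).
  assert (V3 : (8 * e * m <= eps * m)%R) by (apply Rmult_le_compat_r; lra).
  lra.
Qed.

Lemma is_derive_Cexp (z : C) : is_derive Cexp z (Cexp z).
Proof.
  apply is_derive_C_iff. intros eps Heps.
  assert (Hz := exp_pos (Re z)).
  destruct (Cexp_minus_1_bound (eps / exp (Re z))) as [d [Hd B]].
  { apply Rdiv_lt_0_compat; assumption. }
  exists d. split; [assumption|]. intros w Hw.
  specialize (B (w - z) Hw).
  replace (Cexp w) with (Cexp z * Cexp (w - z)).
  2: { rewrite <- Cexp_plus. f_equal. ring. }
  replace (_ - _ - _) with (Cexp z * (Cexp (w - z) - 1 - (w - z))) by ring.
  rewrite Cmod_mult, Cmod_Cexp.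
  apply Rmult_le_compat_l with (r := exp (Re z)) in B; [|lra].
  eapply Rle_trans; [exact B|]. right. field. lra.
Qed.

(** The sine of an [acos] is nonnegative, here [|Im w| / |w|]; the case split in [Carg] restores the
    sign. *)
Lemma cos_sin_Carg (w : C) : w <> 0 ->
  cos (Carg w) = (Re w / Cmod w)%R /\ sin (Carg w) = (Im w / Cmod w)%R.
Proof.
  intros Hw. apply Cmod_gt_0 in Hw.
  assert (Hr := re_le_Cmod w).
  assert (B : (-1 <= Re w / Cmod w <= 1)%R).
  { apply Rabs_le_between. rewrite Rabs_div by lra.
    rewrite (Rabs_pos_eq (Cmod w)) by lra.
    apply Rle_div_l; lra. }
  assert (S : sin (acos (Re w / Cmod w)) = (Rabs (Im w) / Cmod w)%R).
  { rewrite sin_acos by assumption.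
    replace (1 - (Re w / Cmod w)²)%R with ((Rabs (Im w) / Cmod w) ^ 2)%R.
    - apply sqrt_pow2. apply Rdiv_le_0_compat; [apply Rabs_pos | assumption].
    - assert (E := Cmod2_alt w). unfold Rsqr.
      unfold Rdiv at 1. rewrite Rpow_mult_distr, pow2_abs.
      replace (Im w ^ 2)%R with (Cmod w ^ 2 - Re w ^ 2)%R by lra. field. lra. }
  unfold Carg. destruct (Rle_dec 0 (Im w)) as [H|H].
  - rewrite cos_acos, S by assumption. rewrite Rabs_pos_eq; auto.
  - rewrite cos_neg, sin_neg, cos_acos, S by assumption.
    rewrite Rabs_left by lra. split; auto. field. lra.
Qed.

Lemma Cexp_Clog (w : C) : w <> 0 -> Cexp (Clog w) = w.
Proof.
  intros Hw. destruct (cos_sin_Carg w Hw) as [Hc Hs].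
  apply Cmod_gt_0 in Hw.
  unfold Cexp, Clog; simpl. rewrite Hc, Hs, exp_ln by assumption.
  destruct w as [x y]; simpl in *. f_equal; field; lra.
Qed.

(** A positive cosine confines [Carg w] to [(-PI/2, PI/2)], where [atan] inverts [tan]. The formula
    has no case split, so continuity in the right half-plane becomes visible. *)
Lemma Carg_atan (w : C) : (0 < Re w)%R -> Carg w = atan (Im w / Re w).
Proof.
  intros Hw.
  assert (Hw0 : w <> 0) by (intros ->; simpl in Hw; lra).
  destruct (cos_sin_Carg w Hw0) as [Hc Hs].
  apply Cmod_gt_0 in Hw0.
  assert (Hpos : (0 < Re w / Cmod w)%R) by (apply Rdiv_lt_0_compat; assumption).
  assert (HPI := PI_RGT_0).
  assert (B : (- PI / 2 < Carg w < PI / 2)%R).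
  { rewrite <- Hc in Hpos. revert Hpos. unfold Carg.
    assert (B := acos_bound (Re w / Cmod w)).
    assert (L : (PI / 2 <= acos (Re w / Cmod w))%R ->
                (cos (acos (Re w / Cmod w)) <= 0)%R)
      by (intros; apply cos_le_0; lra).
    destruct (Rle_dec 0 (Im w)); rewrite ?cos_neg; intros Hpos;
      destruct (Rlt_le_dec (acos (Re w / Cmod w)) (PI / 2)); lra. }
  rewrite <- (atan_tan (Carg w)) by lra. f_equal.
  unfold tan. rewrite Hc, Hs. field. lra.
Qed.

Lemma continuous_Clog (w : C) : (0 < Re w)%R ->
  continuous (Clog : C_UniformSpace -> C_UniformSpace) w.
Proof.
  intros Hw.
  assert (Hw0 : w <> 0) by (intros ->; simpl in Hw; lra).
  apply Cmod_gt_0 in Hw0.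
  assert (Cf : continuous (fun v : R * R => fst v) w) by apply continuous_fst.
  assert (Cs : continuous (fun v : R * R => snd v) w) by apply continuous_snd.
  apply (continuous_ext_loc (U := C_UniformSpace) _
    (fun v : R * R => (ln (Cmod v), atan (snd v / fst v)))).
  - assert (L : locally w (fun v : R * R => 0 < fst v)%R)
      by (apply Cf; apply (open_gt 0); exact Hw).
    revert L. apply filter_imp. intros v Hv. unfold Clog.
    rewrite Carg_atan by exact Hv. reflexivity.
  - apply (continuous_comp_2 (fun v : R * R => ln (Cmod v))
      (fun v : R * R => atan (snd v / fst v)) (fun a b : R => (a, b))).
    + apply (continuous_comp Cmod ln).
      * apply (continuous_ext (fun v : R * R => sqrt (fst v * fst v + snd v * snd v)%R)).
        { intros v. unfold Cmod. f_equal. ring. }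
        apply (continuous_comp (fun v : R * R => fst v * fst v + snd v * snd v)%R sqrt).
        -- apply (continuous_plus (fun v : R * R => fst v * fst v)%R
             (fun v : R * R => snd v * snd v)%R);
             apply (continuous_mult (K := R_AbsRing)); first [exact Cf | exact Cs].
        -- apply continuous_sqrt.
      * apply continuity_pt_filterlim. apply derivable_continuous_pt.
        exists (/ Cmod w)%R. apply derivable_pt_lim_ln. exact Hw0.
    + apply (continuous_comp (fun v : R * R => snd v / fst v)%R atan).
      * apply (continuous_mult (K := R_AbsRing) (fun v : R * R => snd v)
          (fun v : R * R => / fst v)%R); [exact Cs|].
        apply (continuous_comp (fun v : R * R => fst v) Rinv); [exact Cf|].
        apply continuous_Rinv. unfold Re in Hw. lra.
      * apply continuity_pt_filterlim. apply derivable_continuous_pt, derivable_pt_atan.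
    + apply (continuous_ext (fun v : R * R => v)); [intros []; reflexivity|].
      apply continuous_id.
Qed.

(** Balls of the product uniform structure are squares, which costs a factor [sqrt 2], rounded up to
    2. *)
Lemma ball_C_Cmod (z w : C) (eps : posreal) :
  ball (z : C_UniformSpace) eps w -> (Cmod (w - z) < 2 * eps)%R.
Proof.
  intros H. apply C_NormedModule_mixin_compat2 in H.
  eapply Rlt_le_trans; [exact H|].
  apply Rmult_le_compat_r; [apply Rlt_le, cond_pos|].
  rewrite <- (sqrt_pow2 2) at 2 by lra. apply sqrt_le_1; lra.
Qed.

Lemma continuous_C_bound (f : C -> C) (z : C) :
  continuous (f : C_UniformSpace -> C_UniformSpace) z ->
  forall eps : R, (0 < eps)%R -> exists d : R, (0 < d)%R /\
    forall w : C, (Cmod (w - z) < d)%R -> (Cmod (f w - f z) < eps)%R.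
Proof.
  intros H eps Heps.
  assert (He : (0 < eps / 2)%R) by lra.
  destruct (proj1 (filterlim_locally _ _) H (mkposreal _ He)) as [d Hd].
  exists d. split. apply cond_pos. intros w Hw.
  assert (B : ball (z : C_UniformSpace) d w) by (apply C_NormedModule_mixin_compat1; exact Hw).
  replace eps with (2 * (eps / 2))%R by field.
  exact (ball_C_Cmod _ _ (mkposreal _ He) (Hd w B)).
Qed.

(** Inverse function argument: [Clog] is a continuous right inverse of [Cexp], so the first-order
    estimate of [Cexp] at [Clog w] can be solved for the increment [k] of [Clog]. *)
Lemma is_derive_Clog (w : C) : (0 < Re w)%R -> is_derive Clog w (/ w).
Proof.
  intros Hw.
  assert (Hw0 : w <> 0) by (intros ->; simpl in Hw; lra).
  assert (Hm := proj1 (Cmod_gt_0 w) Hw0).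
  apply is_derive_C_iff. intros eps Heps.
  (* The first bound yields [|k| |w| <= 2 |v - w|]; with it, the second turns the error [e |k|] into
     at most [eps |w| |v - w|]. *)
  set (e := Rmin (Cmod w / 2) (eps * Cmod w * Cmod w / 2)).
  assert (He : (0 < e)%R).
  { apply Rmin_glb_lt; [lra|].
    assert (0 < eps * Cmod w * Cmod w)%R by (repeat apply Rmult_lt_0_compat; assumption). lra. }
  assert (He1 : (e <= Cmod w / 2)%R) by apply Rmin_l.
  assert (He2 : (e <= eps * Cmod w * Cmod w / 2)%R) by apply Rmin_r.
  assert (D := is_derive_Cexp (Clog w)). rewrite Cexp_Clog in D by assumption.
  destruct (proj1 (is_derive_C_iff _ _ _) D e He) as [d1 [Hd1 B1]].
  destruct (continuous_C_bound Clog w (continuous_Clog w Hw) d1 Hd1) as [d2 [Hd2 B2]].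
  exists (Rmin d2 (Cmod w)). split; [apply Rmin_glb_lt; assumption|].
  intros v Hv.
  assert (Hv2 := Rlt_le_trans _ _ _ Hv (Rmin_l _ _)).
  assert (Hvw := Rlt_le_trans _ _ _ Hv (Rmin_r _ _)).
  assert (Hv0 : v <> 0).
  { intros ->. replace (0 - w) with (- w) in Hvw by ring.
    rewrite Cmod_opp in Hvw. lra. }
  specialize (B1 (Clog v) (B2 v Hv2)).
  rewrite !Cexp_Clog in B1 by assumption.
  set (k := Clog v - Clog w) in *. clearbody k.
  assert (T := Cmod_triangle_minus (k * w) (v - w)).
  replace (k * w - (v - w)) with (- (v - w - k * w)) in T by ring.
  rewrite Cmod_opp, Cmod_mult in T.
  assert (Pk := Cmod_ge_0 k).
  assert (Hk : (Cmod k * Cmod w <= 2 * Cmod (v - w))%R).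
  { assert (e * Cmod k <= Cmod w / 2 * Cmod k)%R by (apply Rmult_le_compat_r; lra). lra. }
  replace (k - (v - w) * / w) with (- ((v - w - k * w) / w)) by (field; assumption).
  rewrite Cmod_opp, Cmod_div by assumption.
  apply Rle_div_l; [assumption|].
  eapply Rle_trans; [exact B1|].
  eapply Rle_trans; [apply Rmult_le_compat_r; [assumption | exact He2]|].
  assert (eps * Cmod w * (Cmod k * Cmod w) <= eps * Cmod w * (2 * Cmod (v - w)))%R.
  { apply Rmult_le_compat_l; [|assumption]. apply Rmult_le_pos; lra. }
  lra.
Qed.

(** * Factorisation and partial fractions *)

(** Horner form with [n] as an upper bound on the degree. A predicate on functions turns division by
    a linear factor and root counting into short inductions. *)
Fixpoint is_poly (n : nat) (f : C -> C) : Prop :=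
  match n with
  | O => exists c, forall z, f z = c
  | S n => exists c g, is_poly n g /\ forall z, f z = c + z * g z
  end.

Lemma is_poly_ext (n : nat) (f g : C -> C) :
  (forall z, f z = g z) -> is_poly n f -> is_poly n g.
Proof.
  intros E. destruct n; simpl.
  - intros [c H]. exists c. intros z. now rewrite <- E.
  - intros [c [h [Hh H]]]. exists c, h. split; auto. intros z. now rewrite <- E.
Qed.

Lemma is_poly_const (n : nat) (c : C) : is_poly n (fun _ => c).
Proof.
  revert c. induction n as [|n IH]; intros c; simpl.
  - now exists c.
  - exists c, (fun _ => 0). split; auto. intros; ring.
Qed.

Lemma is_poly_plus (n : nat) (f g : C -> C) :
  is_poly n f -> is_poly n g -> is_poly n (fun z => f z + g z).
Proof.
  revert f g. induction n as [|n IH]; simpl; intros f g.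
  - intros [c Hc] [d Hd]. exists (c + d). intros z. now rewrite Hc, Hd.
  - intros [c [f' [Hf' Hf]]] [d [g' [Hg' Hg]]].
    exists (c + d), (fun z => f' z + g' z). split; auto.
    intros z. rewrite Hf, Hg. ring.
Qed.

Lemma is_poly_scal (n : nat) (k : C) (f : C -> C) :
  is_poly n f -> is_poly n (fun z => k * f z).
Proof.
  revert f. induction n as [|n IH]; simpl; intros f.
  - intros [c Hc]. exists (k * c). intros z. now rewrite Hc.
  - intros [c [f' [Hf' Hf]]].
    exists (k * c), (fun z => k * f' z). split; auto.
    intros z. rewrite Hf. ring.
Qed.

Lemma is_poly_S (n : nat) (f : C -> C) : is_poly n f -> is_poly (S n) f.
Proof.
  revert f. induction n as [|n IH]; intros f.
  - intros [c Hc]. exists c, (fun _ => 0). split; [apply is_poly_const|].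
    intros z. rewrite Hc. ring.
  - intros [c [f' [Hf' Hf]]]. exists c, f'. split; auto.
Qed.

Lemma is_poly_mult_X (n : nat) (f : C -> C) :
  is_poly n f -> is_poly (S n) (fun z => z * f z).
Proof.
  intros H. exists 0, f. split; auto. intros; ring.
Qed.

Lemma is_poly_pow (n : nat) : is_poly n (fun z => z ^ n).
Proof.
  induction n as [|n IH].
  - now exists 1.
  - exact (is_poly_mult_X n _ IH).
Qed.

Lemma is_poly_sum_n_m (n : nat) (f : nat -> C -> C) (a b : nat) :
  (forall k, (a <= k <= b)%nat -> is_poly n (f k)) ->
  is_poly n (fun z => sum_n_m (fun k => f k z) a b).
Proof.
  intros H. destruct (Nat.le_gt_cases a b) as [L|L].
  - induction L as [|b L IH].
    + apply (is_poly_ext n (f a)); [|apply H; lia].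
      intros z. now rewrite sum_n_n.
    + apply (is_poly_ext n (fun z => sum_n_m (fun k => f k z) a b + f (S b) z)).
      * intros z. rewrite sum_n_Sm by lia. reflexivity.
      * apply is_poly_plus; [apply IH; intros; apply H; lia | apply H; lia].
  - apply (is_poly_ext n (fun _ => 0)); [|apply is_poly_const].
    intros z. now rewrite sum_n_m_zero by assumption.
Qed.

Lemma is_poly_le (m n : nat) (f : C -> C) : (m <= n)%nat -> is_poly m f -> is_poly n f.
Proof.
  induction 1; auto using is_poly_S.
Qed.

Lemma is_poly_qpoly (N : nat) (q : nat -> R) : is_poly N (qpoly N q).
Proof.
  apply (is_poly_sum_n_m N (fun k z => RtoC (q k) * z ^ k)). intros k Hk.
  apply is_poly_scal, (is_poly_le k); [lia|]. apply is_poly_pow.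
Qed.

(** Synthetic division: [f' z = f' a + (z - a) * g z] implies [z * f' z - a * f' a = (z - a) * (f' a
    + z * g z)]. *)
Lemma is_poly_div_linear (n : nat) (f : C -> C) (a : C) :
  is_poly (S n) f ->
  exists g, is_poly n g /\ forall z, f z = f a + (z - a) * g z.
Proof.
  revert f. induction n as [|n IH]; intros f [c [f' [Hf' Hf]]].
  - destruct Hf' as [d Hd]. exists (fun _ => d). split; [now exists d|].
    intros z. rewrite !Hf, !Hd. ring.
  - destruct (IH f' Hf') as [g [Hg E]].
    exists (fun z => f' a + z * g z). split.
    + exists (f' a), g. auto.
    + intros z. rewrite !Hf, (E z). ring.
Qed.

(** One node is divided out per degree; since the nodes are distinct, the quotient vanishes at all
    the others. *)
Lemma is_poly_eq_0 (n : nat) (f : C -> C) (x : nat -> C) :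
  is_poly n f ->
  (forall i j, (i <= n)%nat -> (j <= n)%nat -> x i = x j -> i = j) ->
  (forall i, (i <= n)%nat -> f (x i) = 0) ->
  forall z, f z = 0.
Proof.
  revert f. induction n as [|n IH]; intros f Hf Hx H0 z.
  - destruct Hf as [c Hc]. rewrite Hc, <- (Hc (x 0%nat)). auto.
  - destruct (is_poly_div_linear n f (x (S n)) Hf) as [g [Hg E]].
    assert (Hg0 : forall i, (i <= n)%nat -> g (x i) = 0).
    { intros i Hi. specialize (E (x i)). rewrite !H0, Cplus_0_l in E by lia.
      assert (D : x i - x (S n) <> 0).
      { intros D. assert (i = S n); [|lia].
        apply Hx; try lia.
        replace (x i) with (x i - x (S n) + x (S n)) by ring. rewrite D. ring. }
      replace (g (x i)) with ((x i - x (S n)) * g (x i) / (x i - x (S n)))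
        by (field; assumption).
      rewrite <- E. field. assumption. }
    rewrite E, H0, (IH g) by (auto; intros; apply Hx; auto; lia). ring.
Qed.

(* Interpolation at the N + 1 points 0, b_1, ..., b_N. *)
Lemma is_poly_eq (N : nat) (f g : C -> C) (b : nat -> C) :
  is_poly N f -> is_poly N g ->
  (forall j, (1 <= j <= N)%nat -> b j <> 0) ->
  (forall i j, (1 <= i <= N)%nat -> (1 <= j <= N)%nat -> b i = b j -> i = j) ->
  f 0 = g 0 ->
  (forall j, (1 <= j <= N)%nat -> f (b j) = g (b j)) ->
  forall z, f z = g z.
Proof.
  intros Hf Hg Hb0 Hb H0 H z.
  set (x := fun j => match j with O => RtoC 0 | S _ => b j end).
  assert (E : f z + (- (1)) * g z = 0).
  { apply (is_poly_eq_0 N (fun z => f z + (- (1)) * g z) x).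
    - apply is_poly_plus; [|apply is_poly_scal]; assumption.
    - intros [|i] [|j] Hi Hj E; simpl in E; auto.
      + exfalso. apply (Hb0 (S j)); [lia | auto].
      + exfalso. apply (Hb0 (S i)); [lia | auto].
      + apply Hb; auto; lia.
    - intros [|i] Hi; simpl; [rewrite H0 | rewrite H by lia]; ring. }
  replace (f z) with (f z + (- (1)) * g z + g z) by ring. rewrite E. ring.
Qed.

(** * Finite products and products of linear factors *)

Lemma Cprod_n_m_S (a : nat -> C) (n : nat) :
  Cprod_n_m a 1 (S n) = Cprod_n_m a 1 n * a (S n).
Proof.
  unfold Cprod_n_m.
  rewrite (Iter.iter_nat_Chasles Cmult 1 Cmult_1_l Cmult_assoc a 1 n (S n)) by lia.
  now rewrite Iter.iter_nat_point by apply Cmult_1_r.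
Qed.

Lemma Cprod_n_m_0 (a : nat -> C) : Cprod_n_m a 1 0 = 1.
Proof.
  reflexivity.
Qed.

Lemma Cprod_n_m_ext (a c : nat -> C) (m n : nat) :
  (forall k, (m <= k <= n)%nat -> a k = c k) -> Cprod_n_m a m n = Cprod_n_m c m n.
Proof.
  apply Iter.iter_nat_ext_loc.
Qed.

Lemma Cprod_n_m_mult (a c : nat -> C) (n : nat) :
  Cprod_n_m (fun j => a j * c j) 1 n = Cprod_n_m a 1 n * Cprod_n_m c 1 n.
Proof.
  induction n as [|n IH].
  - rewrite !Cprod_n_m_0. ring.
  - rewrite !Cprod_n_m_S, IH. ring.
Qed.

Lemma Cprod_n_m_eq_0 (a : nat -> C) (n j : nat) :
  (1 <= j <= n)%nat -> a j = 0 -> Cprod_n_m a 1 n = 0.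
Proof.
  induction n as [|n IH]; intros Hj H0; [lia|].
  rewrite Cprod_n_m_S. destruct (Nat.eq_dec j (S n)) as [->|Hn].
  - rewrite H0. ring.
  - rewrite IH by (auto; lia). ring.
Qed.

Lemma Cprod_n_m_neq_0 (a : nat -> C) (n : nat) :
  (forall j, (1 <= j <= n)%nat -> a j <> 0) -> Cprod_n_m a 1 n <> 0.
Proof.
  induction n as [|n IH]; intros H.
  - rewrite Cprod_n_m_0. apply C1_nz.
  - rewrite Cprod_n_m_S. apply Cmult_neq_0; [apply IH; intros; apply H; lia|].
    apply H. lia.
Qed.

Lemma Cprod_n_m_1 (a : nat -> C) (n : nat) :
  (forall j, (1 <= j <= n)%nat -> a j = 1) -> Cprod_n_m a 1 n = 1.
Proof.
  induction n as [|n IH]; intros H; [apply Cprod_n_m_0|].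
  rewrite Cprod_n_m_S, IH, H by (intros; try apply H; lia). ring.
Qed.

(** The [c j] are reciprocals of roots, so the product is normalised to 1 at [z = 0]. *)
Definition linear_prod (N : nat) (c : nat -> C) (z : C) : C :=
  Cprod_n_m (fun j => 1 - z * c j) 1 N.

(** A zero reciprocal root makes its factor equal to 1, so a product with one factor left out is
    again a [linear_prod] over the same range. *)
Definition omit (j : nat) (c : nat -> C) (i : nat) : C :=
  if Nat.eq_dec i j then 0 else c i.

Lemma is_poly_linear_prod (N : nat) (c : nat -> C) : is_poly N (linear_prod N c).
Proof.
  induction N as [|N IH].
  - exists 1. intros z. apply Cprod_n_m_0.
  - apply (is_poly_ext (S N)
      (fun z => linear_prod N c z + (- c (S N)) * (z * linear_prod N c z))).
    + intros z. unfold linear_prod. rewrite Cprod_n_m_S. ring.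
    + apply is_poly_plus; [apply is_poly_S, IH|].
      apply is_poly_scal, is_poly_mult_X, IH.
Qed.

Lemma linear_prod_omit (N j : nat) (c : nat -> C) (z : C) :
  (1 <= j <= N)%nat ->
  linear_prod N c z = (1 - z * c j) * linear_prod N (omit j c) z.
Proof.
  intros Hj. unfold linear_prod.
  transitivity (Cprod_n_m (fun i => (if Nat.eq_dec i j then 1 - z * c j else 1)
                                    * (1 - z * omit j c i)) 1 N).
  - apply Cprod_n_m_ext. intros i _. unfold omit.
    destruct (Nat.eq_dec i j) as [->|]; ring.
  - rewrite Cprod_n_m_mult. f_equal.
    clear - Hj. induction N as [|N IH]; [lia|].
    rewrite Cprod_n_m_S. destruct (Nat.eq_dec (S N) j) as [<-|Hn].
    + rewrite Cprod_n_m_1; [ring|]. intros i Hi. destruct (Nat.eq_dec i (S N)); [lia|auto].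
    + rewrite IH by lia. ring.
Qed.

(* Coquelicot equips C with two distinct normed-module structures over itself. *)
Lemma is_derive_C_AbsRing (f : C -> C) (z l : C) :
  is_derive (V := C_NormedModule) f z l <->
  is_derive (V := AbsRing_NormedModule C_AbsRing) f z l.
Proof.
  split; intros [_ H]; (split; [apply is_linear_scal_l | exact H]).
Qed.

Lemma is_derive_C_ext (f g : C -> C) (z df dg : C) :
  (forall w, f w = g w) -> df = dg -> is_derive f z df -> is_derive g z dg.
Proof.
  intros E <-. apply is_derive_ext. exact E.
Qed.

Lemma is_derive_C_mult (f g : C -> C) (z df dg : C) :
  is_derive f z df -> is_derive g z dg ->
  is_derive (fun w => f w * g w) z (df * g z + f z * dg).
Proof.
  rewrite !is_derive_C_AbsRing. intros Hf Hg.
  exact (is_derive_mult (K := C_AbsRing) f g z df dg Hf Hg Cmult_comm).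
Qed.

Lemma is_derive_C_plus (f g : C -> C) (z df dg : C) :
  is_derive f z df -> is_derive g z dg ->
  is_derive (fun w => f w + g w) z (df + dg).
Proof.
  exact (is_derive_plus (K := C_AbsRing) (V := C_NormedModule) f g z df dg).
Qed.

Lemma is_derive_C_const (c z : C) : is_derive (fun _ : C => c) z (RtoC 0).
Proof.
  exact (is_derive_const (K := C_AbsRing) (V := C_NormedModule) c z).
Qed.

Lemma is_derive_C_linear (a k z : C) : is_derive (fun w => a + k * w) z k.
Proof.
  apply is_derive_C_iff. intros eps Heps. exists 1%R. split; [lra|]. intros w _.
  replace (_ - _ - _) with (RtoC 0) by ring. rewrite Cmod_0.
  apply Rmult_le_pos; [lra | apply Cmod_ge_0].
Qed.

Lemma is_derive_C_comp (f g : C -> C) (z df dg : C) :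
  is_derive f (g z) df -> is_derive g z dg -> is_derive (fun w => f (g w)) z (dg * df).
Proof.
  intros Hf Hg. rewrite is_derive_C_AbsRing in Hg.
  exact (is_derive_comp (K := C_AbsRing) (V := C_NormedModule) f g z df dg Hf Hg).
Qed.

Lemma is_poly_ex_derive (n : nat) (f : C -> C) (z : C) : is_poly n f -> ex_derive f z.
Proof.
  revert f z. induction n as [|n IH]; simpl; intros f z.
  - intros [c Hc]. apply (ex_derive_ext (fun _ => c)); [auto|]. apply ex_derive_const.
  - intros [c [g [Hg Hf]]]. apply (ex_derive_ext (fun z => c + z * g z)); [auto|].
    destruct (IH g z Hg) as [l Hl].
    eexists. apply is_derive_C_plus; [apply is_derive_C_const|].
    apply is_derive_C_mult; [|exact Hl].
    eapply (is_derive_C_ext (fun w => 0 + 1 * w)); [intros; ring | | apply is_derive_C_linear].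
    reflexivity.
Qed.

(** * Size of q on the unit disc *)

Definition qsum (N : nat) (q : nat -> R) : R := sum_n_m q 1 N.

Lemma sum_n_m_1_S {G : AbelianMonoid} (a : nat -> G) (n : nat) :
  sum_n_m a 1 (S n) = plus (sum_n_m a 1 n) (a (S n)).
Proof.
  apply sum_n_Sm. lia.
Qed.

Lemma qpoly_S (N : nat) (q : nat -> R) (z : C) :
  qpoly (S N) q z = qpoly N q z + RtoC (q (S N)) * z ^ S N.
Proof.
  apply (sum_n_m_1_S (G := C_AbelianMonoid) (fun j => RtoC (q j) * z ^ j)).
Qed.

Lemma qsum_S (N : nat) (q : nat -> R) : qsum (S N) q = (qsum N q + q (S N))%R.
Proof.
  apply (sum_n_m_1_S (G := R_AbelianMonoid)).
Qed.

Lemma qpoly_1 (N : nat) (q : nat -> R) : qpoly N q 1 = RtoC (qsum N q).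
Proof.
  induction N as [|N IH]; [reflexivity|].
  rewrite qpoly_S, qsum_S, IH, RtoC_plus, Cpow_1_l. ring.
Qed.

Lemma qpoly_0 (N : nat) (q : nat -> R) : qpoly N q 0 = 0.
Proof.
  induction N as [|N IH]; [reflexivity|].
  rewrite qpoly_S, IH. simpl. ring.
Qed.

(** All exponents are at least 1, so [|z| ^ j <= |z|]. The factor [|z|] keeps the roots out of the
    open disc and provides the decay rate of the paths. *)
Lemma Cmod_qpoly_le (N : nat) (q : nat -> R) (z : C) :
  (forall j : nat, (1 <= j <= N)%nat -> (0 <= q j)%R) ->
  (Cmod z <= 1)%R -> (Cmod (qpoly N q z) <= qsum N q * Cmod z)%R.
Proof.
  intros Hq Hz. induction N as [|N IH].
  - replace (qpoly 0 q z) with (RtoC 0) by reflexivity.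
    replace (qsum 0 q) with 0%R by reflexivity. rewrite Cmod_0. lra.
  - rewrite qpoly_S, qsum_S. eapply Rle_trans; [apply Cmod_triangle|].
    rewrite Rmult_plus_distr_r. apply Rplus_le_compat.
    + apply IH. intros; apply Hq; lia.
    + rewrite Cmod_mult, Cmod_R, Cmod_pow, Rabs_pos_eq by (apply Hq; lia).
      apply Rmult_le_compat_l; [apply Hq; lia|]. simpl.
      rewrite <- (Rmult_1_r (Cmod z)) at 3.
      apply Rmult_le_compat_l; [apply Cmod_ge_0|].
      rewrite <- (pow1 N). apply pow_incr. split; [apply Cmod_ge_0 | assumption].
Qed.

Lemma qsum_pos (N : nat) (q : nat -> R) :
  (1 <= N)%nat -> (forall j : nat, (1 <= j <= N)%nat -> (0 <= q j)%R) ->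
  q N <> 0%R -> (0 < qsum N q)%R.
Proof.
  intros HN Hq Hd. destruct N as [|N]; [lia|]. rewrite qsum_S.
  assert (0 <= qsum N q)%R.
  { clear HN Hd. induction N as [|N IH]; [right; reflexivity|].
    rewrite qsum_S.
    assert (0 <= q (S N))%R by (apply Hq; lia).
    assert (0 <= qsum N q)%R by (apply IH; intros j Hj; apply Hq; lia). lra. }
  assert (0 <= q (S N))%R by (apply Hq; lia). lra.
Qed.

Lemma Re_qpoly_gap (N : nat) (q : nat -> R) (z : C) :
  (forall j : nat, (1 <= j <= N)%nat -> (0 <= q j)%R) ->
  (Cmod z <= 1)%R ->
  (qsum N q * (1 - Cmod z) <= - Re (qpoly N q z - qpoly N q 1))%R.
Proof.
  intros Hq Hz. assert (H := Cmod_qpoly_le N q z Hq Hz).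
  rewrite qpoly_1. assert (Hr := re_le_Cmod (qpoly N q z)).
  assert (Ha := Rle_abs (Re (qpoly N q z))).
  replace (Re (qpoly N q z - RtoC (qsum N q))) with (Re (qpoly N q z) - qsum N q)%R
    by (unfold Cminus, Cplus, Copp, RtoC, Re; simpl; ring).
  lra.
Qed.

Lemma Csum_n_m_0 (a : nat -> C) (n : nat) :
  (forall j, (1 <= j <= n)%nat -> a j = 0) -> sum_n_m a 1 n = RtoC 0.
Proof.
  intros H. rewrite (sum_n_m_ext_loc a (fun _ => zero)) by exact H.
  apply (sum_n_m_const_zero (G := C_AbelianMonoid)).
Qed.

Lemma Csum_n_m_single (a : nat -> C) (n k : nat) :
  (1 <= k <= n)%nat -> (forall j, (1 <= j <= n)%nat -> j <> k -> a j = 0) ->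
  sum_n_m a 1 n = a k.
Proof.
  induction n as [|n IH]; intros Hk H; [lia|].
  rewrite (sum_n_m_1_S (G := C_AbelianMonoid)).
  destruct (Nat.eq_dec (S n) k) as [<-|Hn].
  - rewrite Csum_n_m_0 by (intros; apply H; lia). apply Cplus_0_l.
  - rewrite IH, (H (S n)) by (intros; try apply H; lia). apply Cplus_0_r.
Qed.

(** * Roots of q(z) = q(1), residues and partial fractions *)

Section Factorisation.

Variables (N : nat) (q : nat -> R) (b : nat -> C).
Hypothesis N_ge1 : (1 <= N)%nat.
Hypothesis q_ge0 : forall j : nat, (1 <= j <= N)%nat -> (0 <= q j)%R.
Hypothesis deg_q : q N <> 0%R.
Hypothesis b_root : forall j : nat, (1 <= j <= N)%nat -> qpoly N q (b j) = qpoly N q 1.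
Hypothesis b_distinct : forall i j : nat,
  (1 <= i <= N)%nat -> (1 <= j <= N)%nat -> b i = b j -> i = j.

Let c (j : nat) : C := / b j.

Lemma qpoly_1_neq_0 : qpoly N q 1 <> 0.
Proof.
  rewrite qpoly_1. intros E. apply RtoC_inj in E.
  assert (H := qsum_pos N q N_ge1 q_ge0 deg_q). lra.
Qed.

Lemma root_neq_0 (j : nat) : (1 <= j <= N)%nat -> b j <> 0.
Proof.
  intros Hj E. apply qpoly_1_neq_0. rewrite <- (b_root j Hj), E. apply qpoly_0.
Qed.

Lemma Cmod_root_ge_1 (j : nat) : (1 <= j <= N)%nat -> (1 <= Cmod (b j))%R.
Proof.
  intros Hj. apply Rnot_lt_le. intros Hlt.
  assert (H := Cmod_qpoly_le N q (b j) q_ge0 ltac:(lra)).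
  assert (P := qsum_pos N q N_ge1 q_ge0 deg_q).
  rewrite b_root, qpoly_1, Cmod_R, Rabs_pos_eq in H by (auto; lra). nra.
Qed.

Lemma one_minus_div_root_Re (j : nat) (z : C) :
  (1 <= j <= N)%nat -> (Cmod z < 1)%R -> (0 < Re (1 - z / b j))%R.
Proof.
  intros Hj Hz. assert (Hb := Cmod_root_ge_1 j Hj).
  assert (H : (Cmod (z / b j) < 1)%R).
  { rewrite Cmod_div by (apply root_neq_0; assumption).
    apply Rlt_div_l; lra. }
  assert (Hr := re_le_Cmod (z / b j)). assert (Ha := Rle_abs (Re (z / b j))).
  replace (Re (1 - z / b j)) with (1 - Re (z / b j))%R
    by (unfold Cminus, Cplus, Copp, RtoC, Re; simpl; ring).
  lra.
Qed.

(** Both sides have degree at most [N], vanish at the [N] distinct roots and take the value [q(1)]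
    at 0. *)
Lemma qpoly_factorisation (z : C) :
  qpoly N q 1 - qpoly N q z = qpoly N q 1 * linear_prod N c z.
Proof.
  assert (Hn := root_neq_0).
  revert z.
  apply (is_poly_eq N (fun z => qpoly N q 1 - qpoly N q z)
    (fun z => qpoly N q 1 * linear_prod N c z) b); auto.
  - apply (is_poly_ext N (fun z => qpoly N q 1 + (- (1)) * qpoly N q z)).
    + intros; ring.
    + apply is_poly_plus; [apply is_poly_const | apply is_poly_scal, is_poly_qpoly].
  - apply is_poly_scal, is_poly_linear_prod.
  - rewrite qpoly_0. unfold linear_prod. rewrite Cprod_n_m_1 by (intros; ring). ring.
  - intros j Hj. rewrite b_root by assumption.
    rewrite (linear_prod_omit N j) by assumption. unfold c.
    field. auto.
Qed.

Lemma linear_prod_omit_root_neq_0 (j : nat) :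
  (1 <= j <= N)%nat -> linear_prod N (omit j c) (b j) <> 0.
Proof.
  intros Hj. apply Cprod_n_m_neq_0. intros i Hi.
  unfold omit. destruct (Nat.eq_dec i j) as [|Hn].
  - replace (1 - b j * 0) with (RtoC 1) by ring. apply C1_nz.
  - assert (Hi0 := root_neq_0 i Hi). intros E. apply Hn, b_distinct; auto.
    replace (b j) with (b i - b i * (1 - b j * c i)) by (unfold c; field; auto).
    rewrite E. ring.
Qed.

(** With [G] the product of the other factors, [q(z) = q(1) - q(1) (1 - z / b j) G(z)]. The linear
    factor vanishes at [b j], so the term with [G'] drops out. *)
Lemma C_derive_qpoly_root (j : nat) : (1 <= j <= N)%nat ->
  C_derive (qpoly N q) (b j) = qpoly N q 1 * linear_prod N (omit j c) (b j) / b j.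
Proof.
  intros Hj. apply is_C_derive_unique.
  destruct (is_poly_ex_derive N _ (b j) (is_poly_linear_prod N (omit j c))) as [l Hl].
  assert (D := is_derive_C_linear (- qpoly N q 1) (qpoly N q 1 * c j) (b j)).
  assert (M := is_derive_C_plus _ _ _ _ _ (is_derive_C_const (qpoly N q 1) (b j))
    (is_derive_C_mult _ _ _ _ _ D Hl)).
  revert M. apply is_derive_C_ext.
  - intros z. assert (E := qpoly_factorisation z).
    rewrite (linear_prod_omit N j) in E by assumption.
    transitivity (qpoly N q 1 - (qpoly N q 1 - qpoly N q z)); [|ring].
    rewrite E. ring.
  - assert (Hb := root_neq_0 j Hj). unfold c. field. exact Hb.
Qed.

(** The residue of [q(1) / (z (q(1) - q(z)))] at [b j], hence the exponent of [1 - z / b j] in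
    [F]. *)
Definition residue (j : nat) : C :=
  - (qpoly N q 1 / (C_derive (qpoly N q) (b j) * b j)).

Lemma residue_eq (j : nat) : (1 <= j <= N)%nat ->
  residue j = - / linear_prod N (omit j c) (b j).
Proof.
  intros Hj. unfold residue. rewrite C_derive_qpoly_root by assumption.
  field. repeat split; auto using qpoly_1_neq_0, root_neq_0, linear_prod_omit_root_neq_0.
Qed.

(* Partial fractions of [q(1) / (q(1) - q(z))]. *)
Lemma partial_fractions (z : C) :
  linear_prod N c z
  + sum_n_m (fun j => residue j * (linear_prod N c z - linear_prod N (omit j c) z)) 1 N
  = 1.
Proof.
  revert z.
  (* Denominators are cleared. With [G] the full product and [G_j] the product without factor [j],
     the difference [G - G_j] equals [- (z / b j) G_j]; writing it as a difference keeps the degree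
     bound [N] evident. *)
  apply (is_poly_eq N (fun z => linear_prod N c z
    + sum_n_m (fun j => residue j * (linear_prod N c z - linear_prod N (omit j c) z)) 1 N)
    (fun _ => 1) b); auto using root_neq_0.
  - apply is_poly_plus; [apply is_poly_linear_prod|].
    apply (is_poly_sum_n_m N (fun j z =>
      residue j * (linear_prod N c z - linear_prod N (omit j c) z))).
    intros j _. apply is_poly_scal.
    apply (is_poly_ext N (fun z => linear_prod N c z
      + (- (1)) * linear_prod N (omit j c) z)); [intros; ring|].
    apply is_poly_plus; [|apply is_poly_scal]; apply is_poly_linear_prod.
  - apply is_poly_const.
  - assert (L : forall d, linear_prod N d 0 = 1).
    { intros d. apply Cprod_n_m_1. intros; ring. }
    rewrite L, Csum_n_m_0 by (intros; rewrite !L; ring). ring.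
  (* At [b k] the full product vanishes, and so does every omitted product that retains factor [k];
     only the term [j = k] survives. *)
  - intros k Hk.
    assert (L : linear_prod N c (b k) = 0).
    { apply (Cprod_n_m_eq_0 _ N k Hk). unfold c. field. auto using root_neq_0. }
    rewrite (Csum_n_m_single _ N k Hk); rewrite L.
    + rewrite residue_eq by assumption. field. auto using linear_prod_omit_root_neq_0.
    + intros j Hj Hn.
      replace (linear_prod N (omit j c) (b k)) with (RtoC 0); [ring|].
      symmetry. apply (Cprod_n_m_eq_0 _ N k Hk). unfold omit.
      destruct (Nat.eq_dec k j); [congruence|]. unfold c. field. auto using root_neq_0.
Qed.

End Factorisation.

(** * Existence *)

Lemma norm_C_R (z : C) : norm (V := C_R_NormedModule) z = Cmod z.
Proof.
  unfold norm; simpl. unfold prod_norm, norm, Cmod; simpl. unfold abs; simpl.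
  f_equal. rewrite !Rmult_1_r, <- !Rabs_mult.
  rewrite !Rabs_pos_eq by apply Rle_0_sqr. reflexivity.
Qed.

Lemma is_derive_C_R (f : C -> C) (r : R) (l : C) :
  is_derive f (RtoC r) l ->
  is_derive (K := R_AbsRing) (V := C_R_NormedModule) (fun t : R => f (RtoC t)) r l.
Proof.
  intros H. split; [apply is_linear_scal_l|].
  intros x Hx eps.
  apply (is_filter_lim_locally_unique (V := R_NormedModule) r x) in Hx. subst x.
  destruct (proj1 (is_derive_C_iff f (RtoC r) l) H eps (cond_pos eps)) as [d [Hd B]].
  exists (mkposreal d Hd). intros t Ht.
  assert (E : Cmod (RtoC t - RtoC r) = Rabs (t - r)) by (rewrite <- RtoC_minus; apply Cmod_R).
  specialize (B (RtoC t)). rewrite E in B. specialize (B Ht).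
  rewrite norm_C_R. refine (Rle_trans _ _ _ _ B). right. f_equal.
  unfold minus, plus, opp, scal; simpl.
  unfold prod_plus, prod_opp, prod_scal, plus, opp, scal; simpl.
  unfold mult, Cminus, Cplus, Copp, Cmult, RtoC; simpl.
  f_equal; ring.
Qed.

Lemma is_RInt_gen_C_intro (f : R -> C) (I : R -> C) (l : C) :
  (forall b : R, (0 <= b)%R -> is_RInt (V := C_R_NormedModule) f 0 b (I b)) ->
  (forall eps : R, (0 < eps)%R -> exists M : R, forall b : R, (M < b)%R -> (Cmod (I b - l) < eps)%R) ->
  is_RInt_gen (V := C_R_NormedModule) f (at_point 0%R) (Rbar_locally p_infty) l.
Proof.
  intros HI Hl. apply (filterlimi_locally (U := C_R_NormedModule)). intros eps.
  destruct (Hl eps (cond_pos eps)) as [M HM].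
  apply (Filter_prod _ _ _ (fun a => a = 0%R) (fun b => Rmax 0 M < b)%R).
  - reflexivity.
  - exists (Rmax 0 M). auto.
  - intros a b -> Hb. simpl. exists (I b). split.
    + apply HI. assert (H := Rmax_l 0 M). lra.
    + apply C_NormedModule_mixin_compat1. apply HM. assert (H := Rmax_r 0 M). lra.
Qed.

Lemma Re_scal_r (r : R) (a : C) : Re (RtoC r * a) = (r * Re a)%R.
Proof.
  unfold Re, Cmult, RtoC; simpl. ring.
Qed.

Lemma exp_neg_small (k eps : R) : (k < 0)%R -> (0 < eps)%R ->
  exists M : R, forall b : R, (M < b)%R -> (exp (b * k) < eps)%R.
Proof.
  intros Hk He. exists (ln eps / k)%R. intros b Hb.
  rewrite <- (exp_ln eps) by assumption. apply exp_increasing.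
  replace (ln eps) with (ln eps / k * k)%R by (field; lra). nra.
Qed.

Lemma is_derive_spiral (z a t : C) :
  is_derive (fun t => z * Cexp (t * a)) t (a * (z * Cexp (t * a))).
Proof.
  assert (D1 := is_derive_C_linear 0 a t).
  assert (D2 : is_derive (fun t => z * Cexp (0 + a * t)) t
    (0 * Cexp (0 + a * t) + z * (a * Cexp (0 + a * t)))).
  { apply (is_derive_C_mult (fun _ => z) (fun t => Cexp (0 + a * t)));
      [apply is_derive_C_const|].
    apply (is_derive_C_comp Cexp (fun t => 0 + a * t)); [apply is_derive_Cexp | exact D1]. }
  revert D2. apply is_derive_C_ext.
  - intros w. do 2 f_equal. ring.
  - replace (0 + a * t) with (t * a) by ring. ring.
Qed.

Lemma Cmod_spiral (z a : C) (r : R) :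
  Cmod (z * Cexp (RtoC r * a)) = (Cmod z * exp (r * Re a))%R.
Proof.
  rewrite Cmod_mult, Cmod_Cexp, Re_scal_r. reflexivity.
Qed.

Lemma Cmod_spiral_le (z a : C) (r : R) : (Re a < 0)%R -> (0 <= r)%R ->
  (Cmod (z * Cexp (RtoC r * a)) <= Cmod z)%R.
Proof.
  intros Ha Hr. rewrite Cmod_spiral. rewrite <- (Rmult_1_r (Cmod z)) at 2.
  apply Rmult_le_compat_l; [apply Cmod_ge_0|].
  rewrite <- exp_0. destruct (Req_dec (r * Re a) 0) as [->|]; [lra|].
  apply Rlt_le, exp_increasing. nra.
Qed.

(* [r -> F (z exp (r a)) / a] is a primitive of the integrand. *)
Lemma is_RInt_gen_spiral (F Phi : C -> C) (z a : C) :
  (forall w : C, (Cmod w < 1)%R -> exists l, is_derive F w l /\ w * l = Phi w) ->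
  (forall w : C, (Cmod w < 1)%R -> ex_derive Phi w) ->
  F 0 = 0 -> (Cmod z < 1)%R -> (Re a < 0)%R ->
  is_RInt_gen (V := C_R_NormedModule) (fun r : R => Phi (z * Cexp (RtoC r * a)))
    (at_point 0%R) (Rbar_locally p_infty) (F z / (- a)).
Proof.
  intros HF HPhi HF0 Hz Ha.
  assert (Ha0 : a <> 0) by (intros ->; simpl in Ha; lra).
  assert (Hin : forall r, (0 <= r)%R -> (Cmod (z * Cexp (RtoC r * a)) < 1)%R).
  { intros r Hr. eapply Rle_lt_trans; [apply Cmod_spiral_le; assumption | assumption]. }
  (* The first term tends to [F 0 / a = 0], which leaves [- F z / a]. *)
  apply (is_RInt_gen_C_intro _ (fun b => F (z * Cexp (RtoC b * a)) / a - F z / a)).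
  - intros b Hb.
    replace (F z / a) with (F (z * Cexp (RtoC 0 * a)) / a)
      by (rewrite Cmult_0_l, Cexp_0, Cmult_1_r; reflexivity).
    apply (is_RInt_derive (V := C_R_CompleteNormedModule)
      (fun r => F (z * Cexp (RtoC r * a)) / a) (fun r => Phi (z * Cexp (RtoC r * a))));
      rewrite Rmin_left, Rmax_right by assumption; intros r [Hr _].
    + destruct (HF _ (Hin r Hr)) as [l [Hl E]].
      apply (is_derive_C_R (fun t => F (z * Cexp (t * a)) / a)).
      assert (D := is_derive_C_mult _ _ _ _ _
        (is_derive_C_comp F (fun t => z * Cexp (t * a)) (RtoC r) _ _ Hl (is_derive_spiral z a _))
        (is_derive_C_const (/ a) (RtoC r))).
      revert D. apply is_derive_C_ext; [reflexivity|].
      rewrite <- E. field. exact Ha0.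
    + destruct (HPhi _ (Hin r Hr)) as [l Hl].
      apply (ex_derive_continuous (K := R_AbsRing) (V := C_R_NormedModule)).
      eexists. apply (is_derive_C_R (fun t => Phi (z * Cexp (t * a)))).
      apply (is_derive_C_comp Phi (fun t => z * Cexp (t * a)));
        [exact Hl | apply is_derive_spiral].
  - intros eps Heps.
    destruct (HF 0) as [l [Hl _]]; [rewrite Cmod_0; lra|].
    assert (Pa := proj1 (Cmod_gt_0 a) Ha0).
    assert (Pl := Cmod_ge_0 l).
    (* Tolerance 1 gives [|F w| <= (1 + |l|) |w|] for [|w| < d]; this dictates how small [e] must
       be. *)
    destruct (proj1 (is_derive_C_iff _ _ _) Hl 1%R Rlt_0_1) as [d [Hd B]].
    set (e := Rmin d (eps * Cmod a / (1 + Cmod l))).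
    assert (He : (0 < e)%R).
    { apply Rmin_glb_lt; [assumption|]. apply Rdiv_lt_0_compat; [nra | lra]. }
    assert (He1 : (e <= d)%R) by apply Rmin_l.
    assert (He2 : (e * (1 + Cmod l) <= eps * Cmod a)%R).
    { apply Rle_div_r; [lra|]. apply Rmin_r. }
    clearbody e.
    destruct (exp_neg_small (Re a) e Ha He) as [M HM].
    exists M. intros b Hb. specialize (HM b Hb).
    set (w := z * Cexp (RtoC b * a)).
    assert (Hw : (Cmod w < e)%R).
    { unfold w. rewrite Cmod_spiral. assert (P := exp_pos (b * Re a)).
      assert (Q := Cmod_ge_0 z). nra. }
    specialize (B w). replace (w - 0) with w in B by ring.
    specialize (B ltac:(lra)). rewrite HF0 in B.
    replace (F w / a - F z / a - F z / - a) with (F w / a)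
      by (field; repeat split; auto; intros E; apply Ha0;
          replace a with (- - a) by ring; rewrite E; ring).
    rewrite Cmod_div by assumption. apply Rlt_div_l; [assumption|].
    assert (T := Cmod_triangle (F w - 0 - w * l) (w * l)).
    replace (F w - 0 - w * l + w * l) with (F w) in T by ring.
    rewrite Cmod_mult in T. nra.
Qed.

(** * Complex powers and logarithmic derivatives of products *)

Lemma Clog_1 : Clog 1 = 0.
Proof.
  unfold Clog. rewrite Carg_atan by (simpl; lra). rewrite Cmod_1, ln_1. simpl.
  unfold Rdiv. rewrite Rmult_0_l, atan_0. reflexivity.
Qed.

Lemma Cpower_1_l (a : C) : Cpower 1 a = 1.
Proof.
  unfold Cpower. rewrite Clog_1, Cmult_0_r. apply Cexp_0.
Qed.

Lemma Cpower_pred (w a : C) : w <> 0 -> Cpower w (- 1 + a) = Cpower w a * / w.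
Proof.
  intros Hw. unfold Cpower.
  replace ((- 1 + a) * Clog w) with (a * Clog w + - Clog w) by ring.
  rewrite Cexp_plus, Cexp_opp, Cexp_Clog by assumption. reflexivity.
Qed.

Lemma is_derive_Cpower (w a : C) : (0 < Re w)%R ->
  is_derive (fun w => Cpower w a) w (Cpower w a * (a * / w)).
Proof.
  intros Hw.
  assert (D := is_derive_C_comp Cexp (fun w => a * Clog w) w _ _ (is_derive_Cexp (a * Clog w))
    (is_derive_C_mult _ _ _ _ _ (is_derive_C_const a w) (is_derive_Clog w Hw))).
  revert D. apply is_derive_C_ext; [reflexivity|].
  unfold Cpower. ring.
Qed.

(** Writing each derivative as [f j z * l j] makes the product rule an addition of the logarithmic
    derivatives [l j]. *)
Lemma is_derive_Cprod (f : nat -> C -> C) (l : nat -> C) (n : nat) (z : C) :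
  (forall j, (1 <= j <= n)%nat -> is_derive (f j) z (f j z * l j)) ->
  is_derive (fun w => Cprod_n_m (fun j => f j w) 1 n) z
    (Cprod_n_m (fun j => f j z) 1 n * sum_n_m l 1 n).
Proof.
  induction n as [|n IH]; intros H.
  - eapply is_derive_C_ext; [| | apply (is_derive_C_const 1 z)].
    + intros w. now rewrite Cprod_n_m_0.
    + change (sum_n_m l 1 0) with (RtoC 0). ring.
  - assert (D := is_derive_C_mult _ _ _ _ _ (IH (fun j Hj => H j ltac:(lia)))
      (H (S n) ltac:(lia))).
    revert D. apply is_derive_C_ext.
    + intros w. now rewrite Cprod_n_m_S.
    + rewrite Cprod_n_m_S, (sum_n_m_1_S (G := C_AbelianMonoid)).
      change (@plus C_AbelianMonoid) with Cplus. ring.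
Qed.

(** The exponents are a parameter because [F] and [Phi] both have this shape. *)
Definition root_power_prod (N : nat) (b a : nat -> C) (z : C) : C :=
  Cprod_n_m (fun j => Cpower (1 - z / b j) (a j)) 1 N.

Lemma is_derive_root_power_prod (N : nat) (b a : nat -> C) (z : C) :
  (forall j, (1 <= j <= N)%nat -> (0 < Re (1 - z / b j))%R) ->
  is_derive (root_power_prod N b a) z (root_power_prod N b a z *
    sum_n_m (fun j => - / b j * (a j * / (1 - z / b j))) 1 N).
Proof.
  intros H.
  apply (is_derive_Cprod (fun j w => Cpower (1 - w / b j) (a j))).
  intros j Hj.
  assert (L : is_derive (fun w => 1 - w / b j) z (- / b j)).
  { eapply is_derive_C_ext; [| | apply (is_derive_C_linear 1 (- / b j) z)]; [|reflexivity].
    intros w. unfold Cdiv. ring. }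
  assert (D := is_derive_C_comp (fun w => Cpower w (a j)) _ z _ _
    (is_derive_Cpower _ (a j) (H j Hj)) L).
  revert D. apply is_derive_C_ext; [reflexivity|]. ring.
Qed.

Lemma root_power_prod_0 (N : nat) (b a : nat -> C) :
  root_power_prod N b a 0 = 1.
Proof.
  apply Cprod_n_m_1. intros j _.
  replace (1 - 0 / b j) with (RtoC 1) by (unfold Cdiv; ring). apply Cpower_1_l.
Qed.

Lemma is_derive_mult_X (f : C -> C) (z l : C) :
  is_derive f z l -> is_derive (fun w => w * f w) z (f z + z * l).
Proof.
  intros H. assert (D := is_derive_C_mult _ _ _ _ _ (is_derive_C_linear 0 1 z) H).
  revert D. apply is_derive_C_ext; [intros; ring | ring].
Qed.

Section Existence.

Variables (N : nat) (q : nat -> R) (b : nat -> C).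
Hypothesis N_ge1 : (1 <= N)%nat.
Hypothesis q_ge0 : forall j : nat, (1 <= j <= N)%nat -> (0 <= q j)%R.
Hypothesis deg_q : q N <> 0%R.
Hypothesis b_root : forall j : nat, (1 <= j <= N)%nat -> qpoly N q (b j) = qpoly N q 1.
Hypothesis b_distinct : forall i j : nat,
  (1 <= i <= N)%nat -> (1 <= j <= N)%nat -> b i = b j -> i = j.

Let Re_pos (j : nat) (z : C) (Hj : (1 <= j <= N)%nat) (Hz : (Cmod z < 1)%R) :
  (0 < Re (1 - z / b j))%R := one_minus_div_root_Re N q b N_ge1 q_ge0 deg_q b_root j z Hj Hz.

(** The function [F] of the telescoping; the factor [z] comes from the simple pole of [F'/F] at 0,
    with residue 1. *)
Definition residue_primitive (z : C) : C := z * root_power_prod N b (residue N q b) z.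

Definition residue_solution (z : C) : C :=
  z * root_power_prod N b (fun j => - 1 + residue N q b j) z.

Lemma one_minus_div_root_neq_0 (j : nat) (z : C) :
  (1 <= j <= N)%nat -> (Cmod z < 1)%R -> 1 - z / b j <> 0.
Proof.
  intros Hj Hz E. assert (P := Re_pos j z Hj Hz). rewrite E in P. simpl in P. lra.
Qed.

(** Lowering every exponent by one divides by [1 - q(z) / q(1)]. This is what turns
    [F(z) / (q(1) - q(z))] into [Phi(z) / q(1)]. *)
Lemma root_power_prod_pred (z : C) : (Cmod z < 1)%R ->
  root_power_prod N b (fun j => - 1 + residue N q b j) z *
    linear_prod N (fun j => / b j) z = root_power_prod N b (residue N q b) z.
Proof.
  intros Hz. unfold root_power_prod, linear_prod. rewrite <- Cprod_n_m_mult.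
  apply Cprod_n_m_ext. intros j Hj. assert (H := one_minus_div_root_neq_0 j z Hj Hz).
  rewrite Cpower_pred by assumption. change (z * / b j) with (z / b j).
  set (u := 1 - z / b j) in *. clearbody u. field. exact H.
Qed.

Lemma residue_primitive_derive (z : C) : (Cmod z < 1)%R ->
  exists l, is_derive residue_primitive z l /\ z * l = residue_solution z.
Proof.
  intros Hz.
  eexists. split.
  - apply is_derive_mult_X. apply is_derive_root_power_prod. intros; apply Re_pos; assumption.
  - unfold residue_solution.
    rewrite <- root_power_prod_pred by assumption.
    assert (PF := partial_fractions N q b N_ge1 q_ge0 deg_q b_root b_distinct z).
    set (G := linear_prod N (fun j => / b j) z) in *.
    (* Each difference in the sum is [- (z / b j) * G / (1 - z / b j)], so the sum is [z * G] times
       the logarithmic derivative of the product of powers. *)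
    rewrite (sum_n_m_ext_loc _ (fun j => mult (z * G)
      (- / b j * (residue N q b j * / (1 - z / b j))))) in PF.
    + rewrite (sum_n_m_mult_l (K := C_Ring)) in PF.
      set (S := sum_n_m _ _ _) in *.
      change (G + z * G * S = 1) in PF.
      match goal with |- ?x = ?y => change (@eq C x y) end.
      transitivity (z * root_power_prod N b (fun j => - 1 + residue N q b j) z * (G + z * G * S));
        [ring | rewrite PF; ring].
    + intros j Hj. unfold G.
      rewrite (linear_prod_omit N j) by assumption.
      change (@mult C_Ring) with Cmult. change (z * / b j) with (z / b j).
      assert (H := one_minus_div_root_neq_0 j z Hj Hz).
      set (k := linear_prod N (omit j _) z).
      match goal with |- ?x = ?y => change (@eq C x y) end.
      transitivity (- (z * / b j) * residue N q b j * k);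
      [unfold Cdiv; ring|].
      transitivity (- (z * / b j) * residue N q b j * k * ((1 - z / b j) * / (1 - z / b j)));
      [rewrite Cinv_r by assumption; ring | ring].
Qed.

Lemma residue_solution_is_solution : is_solution N q residue_solution.
Proof.
  assert (D : forall z, (Cmod z < 1)%R -> is_derive residue_solution z
    (root_power_prod N b (fun j => - 1 + residue N q b j) z + z *
      (root_power_prod N b (fun j => - 1 + residue N q b j) z *
       sum_n_m (fun j => - / b j * ((- 1 + residue N q b j) * / (1 - z / b j))) 1 N))).
  { intros z Hz. apply is_derive_mult_X, is_derive_root_power_prod.
    intros; apply Re_pos; assumption. }
  assert (A : analytic_on_unit_disc residue_solution) by (intros z Hz; eexists; apply D, Hz).
  split; [exact A|]. split; [|split].
  - intros z Hz.
    assert (Hs := qsum_pos N q N_ge1 q_ge0 deg_q).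
    assert (Ha : (Re (qpoly N q z - qpoly N q 1) < 0)%R).
    { assert (Hg := Re_qpoly_gap N q z q_ge0 ltac:(lra)). nra. }
    replace (residue_solution z / qpoly N q 1)
      with (residue_primitive z / - (qpoly N q z - qpoly N q 1)).
    + apply is_RInt_gen_spiral; auto using residue_primitive_derive.
      unfold residue_primitive. ring.
    + replace (- (qpoly N q z - qpoly N q 1)) with (qpoly N q 1 - qpoly N q z) by ring.
      rewrite (qpoly_factorisation N q b) by assumption.
      unfold residue_primitive, residue_solution.
      rewrite <- root_power_prod_pred by assumption.
      assert (H1 := qpoly_1_neq_0 N q N_ge1 q_ge0 deg_q).
      assert (HG : linear_prod N (fun j => / b j) z <> 0).
      { apply Cprod_n_m_neq_0. intros j Hj.
        exact (one_minus_div_root_neq_0 j z Hj Hz). }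
      field. auto.
  - unfold residue_solution. ring.
  - assert (D0 := D 0 ltac:(rewrite Cmod_0; lra)).
    rewrite root_power_prod_0 in D0. revert D0.
    apply is_derive_C_ext; [reflexivity | ring].
Qed.

End Existence.

(** * Uniqueness *)

(** A single truncation close to the limit suffices, because the barrier bounds truncated integrals
    uniformly in [b]. *)
Lemma is_RInt_gen_C_elim (f : R -> C) (l : C) (eps : R) :
  is_RInt_gen (V := C_R_NormedModule) f (at_point 0%R) (Rbar_locally p_infty) l ->
  (0 < eps)%R ->
  exists (b : R) (y : C), (0 < b)%R /\ is_RInt (V := C_R_NormedModule) f 0 b y /\
    (Cmod (y - l) < eps)%R.
Proof.
  intros H Heps.
  assert (He : (0 < eps / 2)%R) by lra.
  destruct (proj1 (filterlimi_locally (U := C_R_NormedModule) _ _) H (mkposreal _ He))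
    as [Q P HQ [M HM] HQP].
  set (b := (Rmax 0 M + 1)%R).
  assert (Hb0 := Rmax_l 0 M). assert (HbM := Rmax_r 0 M).
  destruct (HQP 0%R b HQ (HM b ltac:(unfold b; lra))) as [y [Hy By]].
  exists b, y. split; [unfold b; lra|]. split; [exact Hy|].
  replace eps with (2 * (eps / 2))%R by field.
  exact (ball_C_Cmod _ _ (mkposreal _ He) By).
Qed.

Lemma is_derive_continuous_bound (f : C -> C) (z l : C) : is_derive f z l ->
  forall eps : R, (0 < eps)%R -> exists d : R, (0 < d)%R /\
    forall w : C, (Cmod (w - z) < d)%R -> (Cmod (f w - f z) < eps)%R.
Proof.
  intros H eps Heps.
  destruct (proj1 (is_derive_C_iff f z l) H 1%R Rlt_0_1) as [d [Hd B]].
  assert (Pl := Cmod_ge_0 l).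
  exists (Rmin d (eps / (1 + Cmod l))). split.
  { apply Rmin_glb_lt; [assumption|]. apply Rdiv_lt_0_compat; lra. }
  intros w Hw.
  assert (Hw1 := Rlt_le_trans _ _ _ Hw (Rmin_l _ _)).
  assert (Hw2 := Rlt_le_trans _ _ _ Hw (Rmin_r _ _)).
  apply Rlt_div_r in Hw2; [|lra]. specialize (B w Hw1).
  assert (T := Cmod_triangle (f w - f z - (w - z) * l) ((w - z) * l)).
  replace (f w - f z - (w - z) * l + (w - z) * l) with (f w - f z) in T by ring.
  rewrite Cmod_mult in T. lra.
Qed.

(** * Comparison of a homogeneous solution with the radial barrier *)

Section Uniqueness.

Variables (s : R) (a D : C -> C).
Hypothesis s_pos : (0 < s)%R.
Hypothesis a_gap : forall z : C, (Cmod z < 1)%R -> (s * (1 - Cmod z) <= - Re (a z))%R.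
Hypothesis D_continuous : forall z : C, (Cmod z < 1)%R ->
  forall eps : R, (0 < eps)%R -> exists d : R, (0 < d)%R /\
    forall w : C, (Cmod (w - z) < d)%R -> (Cmod (D w - D z) < eps)%R.
Hypothesis D_little_o : forall eps : R, (0 < eps)%R -> exists d : R, (0 < d)%R /\
  forall w : C, (Cmod w < d)%R -> (Cmod (D w) <= eps * Cmod w)%R.
Hypothesis D_eq : forall z : C, (Cmod z < 1)%R ->
  is_RInt_gen (V := C_R_NormedModule) (fun r : R => D (z * Cexp (RtoC r * a z)))
    (at_point 0%R) (Rbar_locally p_infty) (D z / RtoC s).

(* [barrier K t = t I'(t)] for [I(t) = t exp (K t)]; once K is large it is a strict
   supersolution of the integral equation in which D is replaced by |D|. *)
Definition barrier (K t : R) : R := (t * (1 + K * t) * exp (K * t))%R.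

(** This linear lower bound lets [D(z) = o(z)] start the comparison near 0, for any prefactor. *)
Lemma barrier_ge (K t : R) : (0 <= K)%R -> (0 <= t)%R -> (t <= barrier K t)%R.
Proof.
  intros HK Ht. unfold barrier.
  assert (0 <= K * t)%R by (apply Rmult_le_pos; assumption).
  assert (1 + K * t <= exp (K * t))%R by apply exp_ineq1_le.
  assert (1 <= (1 + K * t) * exp (K * t))%R by nra.
  rewrite Rmult_assoc. nra.
Qed.

(** Radial telescoping: for [t = rho * exp (- k * r)], the [r]-derivative of
    [I(t) = t * exp (K * t)] is [- k * barrier K t]. *)
Lemma is_RInt_barrier (K rho k b : R) : k <> 0%R ->
  is_RInt (fun r => barrier K (rho * exp (- k * r))) 0 b
    ((rho * exp (K * rho)
      - rho * exp (- k * b) * exp (K * (rho * exp (- k * b)))) / k)%R.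
Proof.
  intros Hk.
  set (J := fun r => (- (rho * exp (- k * r) * exp (K * (rho * exp (- k * r)))) / k)%R).
  replace (_ / k)%R with (minus (J b) (J 0%R)).
  - apply (is_RInt_derive (V := R_CompleteNormedModule) J); intros x _.
    + unfold J, barrier. auto_derive; [exact I|]. field. exact Hk.
    + apply (ex_derive_continuous (K := R_AbsRing) (V := R_NormedModule)).
      unfold barrier. auto_derive. exact I.
  - unfold minus, plus, opp, J; simpl. rewrite Rmult_0_r, exp_0, !Rmult_1_r. field. exact Hk.
Qed.

(** For [r > 0] the path has modulus below [|z|], so the integral equation bounds [D z] by the
    integral of the barrier, and the supersolution property makes the result strict. *)
Lemma barrier_step (K rho0 eps : R) (z : C) :
  (rho0 < 1)%R -> (2 <= K * (1 - rho0))%R -> (0 < eps)%R ->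
  (0 < Cmod z <= rho0)%R ->
  (forall w : C, (Cmod w < Cmod z)%R -> (Cmod (D w) <= eps * barrier K (Cmod w))%R) ->
  (Cmod (D z) < eps * barrier K (Cmod z))%R.
Proof.
  intros Hrho HK Heps Hz Hw.
  set (rho := Cmod z) in *.
  set (k := (- Re (a z))%R).
  assert (Hk : (s * (1 - rho) <= k)%R) by (apply a_gap; fold rho; lra).
  assert (Hk0 : (0 < k)%R) by nra.
  assert (HKr : (0 < K)%R) by nra.
  assert (HE := exp_pos (K * rho)).
  set (B := (eps * (rho * exp (K * rho) / k))%R).
  assert (HB : (Cmod (D z / RtoC s) <= B)%R).
  { apply le_epsilon. intros e He.
    destruct (is_RInt_gen_C_elim _ _ e (D_eq z ltac:(fold rho; lra)) He)
      as [b [y [Hb [Hy Hye]]]].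
    set (lg := (eps * ((rho * exp (K * rho)
      - rho * exp (- k * b) * exp (K * (rho * exp (- k * b)))) / k))%R).
    assert (Hy' : (Cmod y <= lg)%R).
    { rewrite <- norm_C_R.
      apply (norm_RInt_le (V := C_R_NormedModule)
        (* At [r = 0] the path is at [z] itself, where [Hw] says nothing; altering the integrand
           there leaves the integral unchanged. *)
        (fun r => if Rle_dec r 0 then zero else D (z * Cexp (RtoC r * a z)))
        (fun r => scal eps (barrier K (rho * exp (- k * r)))) 0 b); [lra | | | ].
      - intros r Hr. assert (He2 := exp_pos (- k * r)).
        destruct (Rle_dec r 0) as [H|H].
        + rewrite norm_zero. unfold scal; simpl; unfold mult; simpl.
          assert (G := barrier_ge K (rho * exp (- k * r)) ltac:(lra) ltac:(nra)).
          apply Rmult_le_pos; nra.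
        + rewrite norm_C_R.
          assert (E : Cmod (z * Cexp (RtoC r * a z)) = (rho * exp (- k * r))%R).
          { rewrite Cmod_spiral. fold rho. f_equal. f_equal. unfold k. ring. }
          rewrite <- E. apply Hw. rewrite E.
          assert (exp (- k * r) < 1)%R by (rewrite <- exp_0; apply exp_increasing; nra).
          nra.
      - apply (is_RInt_ext (V := C_R_NormedModule) (fun r => D (z * Cexp (RtoC r * a z))));
          [|exact Hy].
        intros r Hr. rewrite Rmin_left in Hr by lra.
        destruct (Rle_dec r 0); [lra | reflexivity].
      - apply (is_RInt_scal (V := R_NormedModule)). apply is_RInt_barrier. lra. }
    (* The endpoint term at [b] is nonnegative and subtracted; dropping it makes the bound
       independent of [b]. *)
    assert (Hlg : (lg <= B)%R).
    { unfold lg, B. apply Rmult_le_compat_l; [lra|].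
      apply Rmult_le_compat_r; [apply Rlt_le, Rinv_0_lt_compat; assumption|].
      assert (0 <= rho * exp (- k * b) * exp (K * (rho * exp (- k * b))))%R.
      { apply Rmult_le_pos; [apply Rmult_le_pos; [lra|]|]; apply Rlt_le, exp_pos. }
      lra. }
    assert (T := Cmod_triangle y (- (y - D z / RtoC s))).
    rewrite Cmod_opp in T.
    replace (y + - (y - D z / RtoC s)) with (D z / RtoC s) in T by ring.
    lra. }
  assert (Hs0 : RtoC s <> 0) by (intros E; apply RtoC_inj in E; lra).
  rewrite Cmod_div, Cmod_R, (Rabs_pos_eq s) in HB by (assumption || lra).
  apply (Rle_div_l _ B s s_pos) in HB.
  assert (HB1 : (B * s * (1 - rho) <= eps * (rho * exp (K * rho)))%R).
  { replace (eps * (rho * exp (K * rho)))%R with (B * k)%R by (unfold B; field; lra).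
    rewrite Rmult_assoc. apply Rmult_le_compat_l; [|assumption].
    unfold B. apply Rmult_le_pos; [lra|]. apply Rdiv_le_0_compat; [nra|assumption]. }
  unfold barrier.
  assert (P : (0 < eps * (rho * exp (K * rho)))%R).
  { apply Rmult_lt_0_compat; [assumption|]. apply Rmult_lt_0_compat; lra. }
  (* From [K * (1 - rho) >= 2] the product is at least [1 + rho]. *)
  assert (Q : (1 < (1 + K * rho) * (1 - rho))%R).
  { assert (K * (1 - rho0) <= K * (1 - rho))%R by (apply Rmult_le_compat_l; lra).
    assert (rho * 2 <= rho * (K * (1 - rho)))%R by (apply Rmult_le_compat_l; lra). lra. }
  apply Rmult_lt_reg_r with (1 - rho)%R; [lra|].
  replace (eps * (rho * (1 + K * rho) * exp (K * rho)) * (1 - rho))%R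
    with (eps * (rho * exp (K * rho)) * ((1 + K * rho) * (1 - rho)))%R by ring.
  assert (Cmod (D z) * (1 - rho) <= B * s * (1 - rho))%R
    by (apply Rmult_le_compat_r; lra).
  nra.
Qed.

(** By continuity a strict inequality persists near each point of the circle, and compactness makes
    the neighbourhood uniform. The compactness theorem needs a gauge on a whole square, so the
    cutoff [|z| < m + e] in [good] deals with points outside the closed disc. *)
Lemma barrier_extend (K m eps : R) :
  (0 < m < 1)%R ->
  (forall z : C, (Cmod z < m)%R -> (Cmod (D z) <= eps * barrier K (Cmod z))%R) ->
  (forall z : C, Cmod z = m -> (Cmod (D z) < eps * barrier K (Cmod z))%R) ->
  exists d : R, (0 < d)%R /\
    forall z : C, (Cmod z < m + d)%R -> (Cmod (D z) <= eps * barrier K (Cmod z))%R.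
Proof.
  intros Hm Hlt Heq.
  set (good := fun (u v : R) (e : posreal) => forall z : C,
    (Rabs (Re z - u) < e)%R -> (Rabs (Im z - v) < e)%R -> (Cmod z < m + e)%R ->
    (Cmod (D z) <= eps * barrier K (Cmod z))%R).
  assert (close : forall (u v e : R) (z : C),
    (Rabs (Re z - u) < e)%R -> (Rabs (Im z - v) < e)%R ->
    (Cmod (z - (u, v)) < 2 * e)%R).
  { intros u v e z Hu Hv. eapply Rle_lt_trans; [apply Cmod_le_Re_Im|].
    unfold Re, Im in *. simpl. fold (Rminus (fst z) u) (Rminus (snd z) v). lra. }
  assert (ex : forall u v : R, exists e : posreal, good u v e).
  { intros u v. set (p := (u, v) : C).
    destruct (Rtotal_order (Cmod p) m) as [H|[H|H]].
    - assert (He : (0 < (m - Cmod p) / 2)%R) by lra.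
      exists (mkposreal _ He). intros z Hu Hv _. simpl in *.
      assert (Cz := close _ _ _ _ Hu Hv). fold p in Cz.
      apply Hlt. assert (T := Cmod_triangle_minus z p). lra.
    - assert (S := Heq p H).
      set (g := (eps * barrier K (Cmod p) - Cmod (D p))%R).
      assert (Hg : (0 < g / 2)%R) by (unfold g; lra).
      destruct (D_continuous p ltac:(lra) (g / 2) Hg) as [d1 [Hd1 B1]].
      assert (CB : continuous (fun t : R => eps * barrier K t)%R (Cmod p)).
      { apply (ex_derive_continuous (K := R_AbsRing) (V := R_NormedModule)).
        unfold barrier. auto_derive. exact I. }
      destruct (proj1 (filterlim_locally _ _) CB (mkposreal _ Hg)) as [d2 B2].
      assert (He : (0 < Rmin d1 d2 / 2)%R)
        by (apply Rdiv_lt_0_compat; [apply Rmin_glb_lt; [assumption | apply cond_pos] | lra]).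
      exists (mkposreal _ He). intros z Hu Hv _. simpl in *.
      assert (Cz := close _ _ _ _ Hu Hv). fold p in Cz.
      assert (M1 := Rmin_l d1 d2). assert (M2 := Rmin_r d1 d2).
      specialize (B1 z ltac:(lra)).
      assert (T1 := Cmod_triangle_minus z p). assert (T2 := Cmod_triangle_minus p z).
      replace (p - z) with (- (z - p)) in T2 by ring. rewrite Cmod_opp in T2.
      assert (T3 := Cmod_triangle_minus (D z) (D p)).
      assert (L : (Rabs (Cmod z - Cmod p) < d2)%R) by (apply Rabs_def1; lra).
      specialize (B2 (Cmod z) L). apply Rabs_lt_between in B2. unfold minus, plus, opp in B2; simpl in B2.
      unfold g in *. lra.
    (* Points of the square around [p] lie within [2 e] of it, hence have modulus above
       [|p| - 2 e = m + 2 e]: the cutoff excludes them all. *)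
    - assert (He : (0 < (Cmod p - m) / 4)%R) by lra.
      exists (mkposreal _ He). intros z Hu Hv Hz. simpl in *.
      assert (Cz := close _ _ _ _ Hu Hv). fold p in Cz.
      assert (T2 := Cmod_triangle_minus p z).
      replace (p - z) with (- (z - p)) in T2 by ring. rewrite Cmod_opp in T2. lra. }
  set (delta := fun u v => proj1_sig (constructive_indefinite_description _ (ex u v))).
  assert (Hdelta : forall u v, good u v (delta u v))
    by (intros u v; exact (proj2_sig (constructive_indefinite_description _ (ex u v)))).
  destruct (compactness_value_2d (-1) 1 (-1) 1 delta) as [d Hd].
  exists (Rmin d (1 - m)). split; [apply Rmin_glb_lt; [apply cond_pos | lra]|].
  intros z Hz.
  assert (M1 := Rmin_l d (1 - m)). assert (M2 := Rmin_r d (1 - m)).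
  assert (R1 := re_le_Cmod z). assert (R2 := Rabs_Im_le_Cmod z).
  assert (H1 : (-1 <= Re z <= 1)%R) by (apply Rabs_le_between; lra).
  assert (H2 : (-1 <= Im z <= 1)%R) by (apply Rabs_le_between; lra).
  destruct (NNPP _ (Hd _ _ H1 H2)) as [u [v [_ [_ [Hu [Hv Hdd]]]]]].
  apply (Hdelta u v z Hu Hv). lra.
Qed.

(** Continuation in the radius: were the supremum [m] of the admissible radii below [rho0],
    [barrier_step] would give strictness on the circle [|z| = m] and [barrier_extend] would go past
    it. *)
Lemma barrier_bound (K rho0 eps : R) :
  (0 < rho0 < 1)%R -> (2 <= K * (1 - rho0))%R -> (0 < eps)%R ->
  forall z : C, (Cmod z < rho0)%R -> (Cmod (D z) <= eps * barrier K (Cmod z))%R.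
Proof.
  intros Hrho HK Heps.
  assert (HK0 : (0 < K)%R) by nra.
  set (E := fun r => (0 < r <= rho0)%R /\
    forall z : C, (Cmod z < r)%R -> (Cmod (D z) <= eps * barrier K (Cmod z))%R).
  destruct (D_little_o eps Heps) as [d0 [Hd0 B0]].
  assert (E0 : E (Rmin d0 rho0)).
  { assert (M1 := Rmin_l d0 rho0). assert (M2 := Rmin_r d0 rho0).
    split; [split; [apply Rmin_glb_lt; lra | assumption]|].
    intros z Hz. eapply Rle_trans; [apply B0; lra|].
    apply Rmult_le_compat_l; [lra|]. apply barrier_ge; [lra | apply Cmod_ge_0]. }
  destruct (completeness E) as [m [Hub Hlub]].
  { exists rho0. intros r [Hr _]. lra. }
  { eauto. }
  assert (Hm1 : (m <= rho0)%R) by (apply Hlub; intros r [Hr _]; lra).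
  assert (Hm0 : (0 < m)%R) by (assert (G := Hub _ E0); destruct E0 as [Hr0 _]; lra).
  assert (Hin : forall z : C, (Cmod z < m)%R -> (Cmod (D z) <= eps * barrier K (Cmod z))%R).
  { intros z Hz. apply NNPP. intros Hn.
    assert (m <= Cmod z)%R; [|lra].
    apply Hlub. intros r [Hr HEr]. apply Rnot_lt_le. intros Hlt. auto. }
  destruct (Rle_lt_or_eq_dec _ _ Hm1) as [Hlt|Heq]; [|rewrite <- Heq; exact Hin].
  exfalso.
  destruct (barrier_extend K m eps) as [d [Hd B]]; [lra | exact Hin | |].
  { intros z Hz. apply (barrier_step K rho0); [lra | assumption | assumption | lra |].
    rewrite Hz. exact Hin. }
  assert (HE : E (Rmin (m + d) rho0)).
  { assert (M1 := Rmin_l (m + d) rho0). assert (M2 := Rmin_r (m + d) rho0).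
    split; [split; [apply Rmin_glb_lt; lra | assumption]|].
    intros z Hz. apply B. lra. }
  apply Hub in HE. assert (m < Rmin (m + d) rho0)%R by (apply Rmin_glb_lt; lra). lra.
Qed.

Lemma homogeneous_solution_zero (z : C) : (Cmod z < 1)%R -> D z = 0.
Proof.
  intros Hz. apply Cmod_eq_0.
  assert (Pz := Cmod_ge_0 z).
  set (rho0 := ((1 + Cmod z) / 2)%R).
  set (K := (2 / (1 - rho0))%R).
  assert (HK : (2 <= K * (1 - rho0))%R)
    by (right; unfold K; field; unfold rho0; lra).
  set (B := barrier K (Cmod z)).
  assert (HB : (0 <= B)%R).
  { eapply Rle_trans; [exact Pz|]. apply barrier_ge; [|assumption].
    unfold K, rho0. apply Rdiv_le_0_compat; lra. }
  apply Rle_antisym; [|apply Cmod_ge_0].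
  apply le_epsilon. intros e He. rewrite Rplus_0_l.
  (* [rho0] and [K] depend on [z] only, so the prefactor can shrink freely; [1 + B] covers the case
     [B = 0]. *)
  assert (H := barrier_bound K rho0 (e / (1 + B)) ltac:(unfold rho0; lra) HK
    ltac:(apply Rdiv_lt_0_compat; lra) z ltac:(unfold rho0; lra)).
  fold B in H. eapply Rle_trans; [exact H|].
  replace (e / (1 + B) * B)%R with (e * (B / (1 + B)))%R by (field; lra).
  rewrite <- (Rmult_1_r e) at 2. apply Rmult_le_compat_l; [lra|].
  apply Rle_div_l; lra.
Qed.

End Uniqueness.

(** Scaling preserves the linear integral equation; the common derivative at 0 removes this freedom
    by cancelling the linear terms of the difference. *)
Lemma is_solution_unique (N : nat) (q : nat -> R) (Phi Psi : C -> C) :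
  (1 <= N)%nat -> (forall j : nat, (1 <= j <= N)%nat -> (0 <= q j)%R) -> q N <> 0%R ->
  is_solution N q Phi -> is_solution N q Psi ->
  forall z : C, (Cmod z < 1)%R -> Phi z = Psi z.
Proof.
  intros HN Hq Hd (A1 & I1 & Z1 & D1) (A2 & I2 & Z2 & D2) z Hz.
  assert (Hs := qsum_pos N q HN Hq Hd).
  assert (E : Phi z - Psi z = 0).
  { revert z Hz.
    apply (homogeneous_solution_zero (qsum N q) (fun z => qpoly N q z - qpoly N q 1)
      (fun z => Phi z - Psi z)); [exact Hs | | | |].
    - intros z Hz. apply Re_qpoly_gap; [assumption | lra].
    - intros z Hz eps Heps.
      destruct (A1 z Hz) as [l1 L1]. destruct (A2 z Hz) as [l2 L2].
      destruct (is_derive_continuous_bound _ _ _ L1 (eps / 2)%R ltac:(lra)) as [d1 [Hd1 B1]].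
      destruct (is_derive_continuous_bound _ _ _ L2 (eps / 2)%R ltac:(lra)) as [d2 [Hd2 B2]].
      exists (Rmin d1 d2). split; [apply Rmin_glb_lt; assumption|]. intros w Hw.
      specialize (B1 w (Rlt_le_trans _ _ _ Hw (Rmin_l _ _))).
      specialize (B2 w (Rlt_le_trans _ _ _ Hw (Rmin_r _ _))).
      replace (_ - _) with ((Phi w - Phi z) + - (Psi w - Psi z)) by ring.
      eapply Rle_lt_trans; [apply Cmod_triangle|]. rewrite Cmod_opp. lra.
    - intros eps Heps.
      destruct (proj1 (is_derive_C_iff _ _ _) D1 (eps / 2)%R ltac:(lra)) as [d1 [Hd1 B1]].
      destruct (proj1 (is_derive_C_iff _ _ _) D2 (eps / 2)%R ltac:(lra)) as [d2 [Hd2 B2]].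
      exists (Rmin d1 d2). split; [apply Rmin_glb_lt; assumption|]. intros w Hw.
      specialize (B1 w). specialize (B2 w).
      replace (w - 0) with w in * by ring. rewrite Z1 in B1. rewrite Z2 in B2.
      specialize (B1 (Rlt_le_trans _ _ _ Hw (Rmin_l _ _))).
      specialize (B2 (Rlt_le_trans _ _ _ Hw (Rmin_r _ _))).
      replace (Phi w - Psi w) with ((Phi w - 0 - w * 1) + - (Psi w - 0 - w * 1)) by ring.
      eapply Rle_trans; [apply Cmod_triangle|]. rewrite Cmod_opp. lra.
    - intros z Hz. rewrite <- qpoly_1.
      replace ((Phi z - Psi z) / qpoly N q 1)
        with (Phi z / qpoly N q 1 - Psi z / qpoly N q 1) by (unfold Cdiv; ring).
      exact (is_RInt_gen_minus (V := C_R_NormedModule) _ _ _ _ (I1 z Hz) (I2 z Hz)). }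
  replace (Phi z) with (Phi z - Psi z + Psi z) by ring. rewrite E. ring.
Qed.

Lemma is_derive_C_ext_disc (f g : C -> C) (z l : C) :
  (forall w : C, (Cmod w < 1)%R -> f w = g w) -> (Cmod z < 1)%R ->
  is_derive f z l -> is_derive g z l.
Proof.
  intros E Hz. rewrite !is_derive_C_iff. intros H eps Heps.
  destruct (H eps Heps) as [d [Hd B]].
  exists (Rmin d (1 - Cmod z)). split; [apply Rmin_glb_lt; lra|]. intros w Hw.
  assert (Hw1 := Rlt_le_trans _ _ _ Hw (Rmin_l _ _)).
  assert (Hw2 := Rlt_le_trans _ _ _ Hw (Rmin_r _ _)).
  assert (T := Cmod_triangle_minus w z).
  rewrite <- !E by lra. auto.
Qed.

(** The paths of integration stay in the open disc, so values elsewhere are irrelevant. This gives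
    the converse direction for any function that follows the formula on the disc. *)
Lemma is_solution_ext (N : nat) (q : nat -> R) (Phi Psi : C -> C) :
  (1 <= N)%nat -> (forall j : nat, (1 <= j <= N)%nat -> (0 <= q j)%R) -> q N <> 0%R ->
  (forall z : C, (Cmod z < 1)%R -> Phi z = Psi z) ->
  is_solution N q Phi -> is_solution N q Psi.
Proof.
  intros HN Hq Hd E (A & I & Z & D).
  assert (H0 : (Cmod 0 < 1)%R) by (rewrite Cmod_0; lra).
  split; [|split; [|split]].
  - intros z Hz. destruct (A z Hz) as [l L]. exists l.
    exact (is_derive_C_ext_disc Phi Psi z l E Hz L).
  - intros z Hz. rewrite <- E by assumption.
    assert (Hs := qsum_pos N q HN Hq Hd).
    assert (Ha : (Re (qpoly N q z - qpoly N q 1) < 0)%R).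
    { assert (Hg := Re_qpoly_gap N q z Hq ltac:(lra)). nra. }
    refine (is_RInt_gen_ext (V := C_R_NormedModule) _ _ _ _ (I z Hz)).
    apply (Filter_prod _ _ _ (fun a => a = 0%R) (fun b => 0 < b)%R).
    + reflexivity.
    + exists 0%R. auto.
    + intros a b -> Hb r Hr. simpl in Hr. rewrite Rmin_left in Hr by lra.
      apply E. eapply Rle_lt_trans; [apply Cmod_spiral_le; lra | exact Hz].
  - rewrite <- E; assumption.
  - exact (is_derive_C_ext_disc Phi Psi 0 1 E H0 D).
Qed.

Theorem corollary1p2 (N : nat) (q : nat -> R) (b : nat -> C)
  (N_ge1 : (1 <= N)%nat)
  (q_ge0 : forall j : nat, (1 <= j <= N)%nat -> (0 <= q j)%R)
  (deg_q : q N <> 0%R)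
  (b_zeros : forall z : C,
     qpoly N q z = qpoly N q 1 <-> exists j : nat, (1 <= j <= N)%nat /\ z = b j)
  (b_distinct : forall i j : nat,
     (1 <= i <= N)%nat -> (1 <= j <= N)%nat -> b i = b j -> i = j)
  (Phi : C -> C) :
  is_solution N q Phi <->
  (forall z : C, (Cmod z < 1)%R ->
     Phi z = z * Cprod_n_m
       (fun j => Cpower (1 - z / b j)
                   (- 1 - qpoly N q 1 / (C_derive (qpoly N q) (b j) * b j))) 1 N).
Proof.
  assert (b_root : forall j, (1 <= j <= N)%nat -> qpoly N q (b j) = qpoly N q 1).
  { intros j Hj. apply b_zeros. eauto. }
  assert (S := residue_solution_is_solution N q b N_ge1 q_ge0 deg_q b_root b_distinct).
  split.
  - intros H z Hz.
    (* [- 1 + residue N q b j] unfolds to the exponent in the statement, so [residue_solution] is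
       convertible to the product formula. *)
    exact (is_solution_unique N q Phi _ N_ge1 q_ge0 deg_q H S z Hz).
  - intros H.
    apply (is_solution_ext N q (residue_solution N q b)); [assumption..| |exact S].
    intros z Hz. symmetry. exact (H z Hz).
Qed.
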